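(* For every trunc $A$, the spectral frame $\mathcal{M}A=2_F\mathcal{K}A$ is a regular Lindelöf frame.
   Context: All $\ell$-groups are divisible abelian lattice-ordered groups, and $A^+=\{a\in A:a\geq 0\}$. A trunc is an $\ell$-group $A$ with a unary operation $a\mapsto\overline{a}$ on $A^+$ such that for all $a,b\in A^+$: (T1) $a\wedge\overline{b}\leq\overline{a}\leq a$; (T2) $\overline{a}=0$ implies $a=0$; (T3) if $na=\overline{na}$ for all $n\in\mathbb{N}$ (positive integers) then $a=0$; (T4) $\bigcap_{n\in\mathbb{N}}(a\ominus n)^{\bot\bot}=0$. Here, for $a\in A^+$, $a\ominus r=a-r\,\overline{a/r}$ for rational $r>0$, and $a\ominus 0=a$; $B^\bot=\{x\in A:|x|\wedge|b|=0\text{ for all }b\in B\}$. Truncs are automatically archimedean. $\overline{A}=\{\overline{a}:a\in A^+\}$. A truncation morphism between truncs is an $\ell$-homomorphism $f$ with $f(\overline{a})=\overline{f(a)}$ for $a\geq 0$. A truncation kernel of $A$ is the set of elements sent to $0$ by some truncation morphism from $A$ into a trunc. $\mathcal{K}A$ is the set of truncation kernels ordered by inclusion; it is a frame, with meet given by intersection and join of a family the truncation kernel generated by its union. $[B]$ denotes the smallest truncation kernel containing $B\subseteq A$. For $a\in A^+$ and rational $r\geq 0$, $a\blacktriangleleft r=\bigvee_{0<s<r}(a\ominus s)^\bot$, $s$ rational, the join taken in $\mathcal{K}A$ (polars are truncation kernels). $F$ is the filter on $\mathcal{K}A$ generated by the kernels $a\blacktriangleleft 1$, $a\in\overline{A}$.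 $2=\{\bot,\top\}$ is the two-element frame. For a frame $L$ and a filter $F$ on $L$, $2_FL=\{(\varepsilon,x)\in 2\times L:\varepsilon=\top\Rightarrow x\in F\}$, a subframe of the product frame $2\times L$. In a frame, $y\prec x$ means that there is $z$ with $y\wedge z=\bot$ and $x\vee z=\top$; a frame is regular if $x=\bigvee\{y:y\prec x\}$ for every $x$. A frame is Lindelöf if every subset $S$ with $\bigvee S=\top$ has an at most countable subset $S_0$ with $\bigvee S_0=\top$. *)

(* Defs.v *)
From HB Require Import structures.
From mathcomp Require Import all_boot all_order all_algebra.
From mathcomp Require Import boolp classical_sets cardinality.

Set Implicit Arguments.
Unset Strict Implicit.
Unset Printing Implicit Defensive.

Import Order.TTheory GRing.Theory Num.Theory.
Local Open Scope classical_set_scope.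
Local Open Scope ring_scope.

(* A frame is determined by its order, so frames, and the notions attached to
   them, are predicates on partially ordered types. [supremums S x] and
   [infimums S x] say that x is the join, resp. the meet, of S. *)
Section Frame.
Context {d : Order.disp_t} {L : porderType d}.
Implicit Types (x y z : L) (S F G : set L).

Definition is_bot x := lbound [set: L] x.
Definition is_top x := ubound [set: L] x.
Definition is_join x y z := supremums [set x; y] z.
Definition is_meet x y z := infimums [set x; y] z.

Definition lattice_filter F : Prop :=
  [/\ forall t, is_top t -> F t,
      forall x y z, F x -> F y -> is_meet x y z -> F z
    & forall x y, F x -> (x <= y)%O -> F y].

Definition generated_filter G : set L := smallest lattice_filter G.

Definition rather_below y x : Prop :=
  exists z b t, [/\ is_bot b, is_top t, is_meet y z b & is_join x z t].

End Frame.

Section FrameProperties.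
Context {d : Order.disp_t} (L : porderType d).

(* The empty meet, i.e. the top, is the join of the whole of L. *)
Definition is_frame : Prop :=
  [/\ forall S : set L, exists x, supremums S x,
      forall x y : L, exists z, is_meet x y z
    & forall (a : L) (S : set L) s m, supremums S s -> is_meet a s m ->
        supremums [set z | exists2 x, S x & is_meet a x z] m].

Definition regular_frame : Prop :=
  forall x : L, supremums [set y | rather_below y x] x.

Definition lindelof_frame : Prop :=
  forall (S : set L) (t : L), is_top t -> supremums S t ->
    exists S0 : set L, [/\ S0 `<=` S, countable S0 & supremums S0 t].

End FrameProperties.

(* The frame 2 is [bool], ordered by false < true; [*p] carries the
   componentwise order. *)
Section TwoF.
Context {d : Order.disp_t} (L : porderType d) (F : set L).

Record two_F := TwoF {
  two_F_val :> bool *p L;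
  _ : `[< two_F_val.1 = true -> F two_F_val.2 >] }.

HB.instance Definition _ := [isSub for two_F_val].
HB.instance Definition _ := [Choice of two_F by <:].
HB.instance Definition _ := [SubChoice_isSubPOrder of two_F by <: with d].

End TwoF.

(* Joining [Order.Lattice] with [GRing.Zmodule] below [Num.RealDomain] is ruled
   out by the existing hierarchy, so the lattice operations are added to
   [porderZmodType], which itself only puts an order and a group together. *)
HB.mixin Record isDivisibleLGroup A of Num.POrderedZmodule A := {
  lmeet : A -> A -> A;
  ljoin : A -> A -> A;
  le_lmeet : forall x y z : A, (z <= lmeet x y) = (z <= x) && (z <= y);
  ljoin_le : forall x y z : A, (ljoin x y <= z) = (x <= z) && (y <= z);
  lgroup_leD2r : forall z x y : A, x <= y -> x + z <= y + z;
  lgroup_divisible : forall (n : nat) (x : A), (0 < n)%N -> exists y, y *+ n = x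
}.

#[short(type="lgroupType")]
HB.structure Definition LGroup :=
  {A of isDivisibleLGroup A & Num.POrderedZmodule A}.

Section LGroupTheory.
Context {A : lgroupType}.
Implicit Types (x : A) (B : set A).

(* The product q x: a lattice-ordered group is torsion-free, so in a divisible
   one exactly one y satisfies the equation below. *)
Definition qscale (q : rat) x : A :=
  xget 0 [set y : A | y *~ denq q = x *~ numq q].

Definition labs x : A := ljoin x (- x).

Definition polar B : set A :=
  [set x | forall b, B b -> lmeet (labs x) (labs b) = 0].

(* a (-) r = a - r (bar (a / r)), for the operation bar on A^+; it is a at r = 0. *)
Definition ominus_of (bar : A -> A) (a : A) (r : rat) : A :=
  a - qscale r (bar (qscale r^-1 a)).

End LGroupTheory.

(* [trunc] is total, but only its values on A^+ are constrained and used. *)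
HB.mixin Record isTrunc A of LGroup A := {
  trunc : A -> A;
  trunc_ge0 : forall a : A, 0 <= a -> 0 <= trunc a;
  truncT1 : forall a b : A, 0 <= a -> 0 <= b ->
    lmeet a (trunc b) <= trunc a /\ trunc a <= a;
  truncT2 : forall a : A, 0 <= a -> trunc a = 0 -> a = 0;
  truncT3 : forall a : A, 0 <= a ->
    (forall n : nat, (0 < n)%N -> a *+ n = trunc (a *+ n)) -> a = 0;
  truncT4 : forall a : A, 0 <= a ->
    \bigcap_(n in [set n : nat | (0 < n)%N])
      polar (polar [set ominus_of trunc a n%:R]) = [set 0]
}.

#[short(type="truncType")]
HB.structure Definition Trunc := {A of isTrunc A & LGroup A}.

Definition ominus {A : truncType} : A -> rat -> A := ominus_of trunc.

Record truncation_morphism {A B : truncType} (f : A -> B) : Prop :=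
  TruncationMorphism {
    truncation_morphismD : {morph f : x y / x + y};
    truncation_morphismI : {morph f : x y / lmeet x y};
    truncation_morphismU : {morph f : x y / ljoin x y};
    truncation_morphism_trunc : forall a, 0 <= a -> f (trunc a) = trunc (f a)
  }.

Section Spectrum.
Variable A : truncType.

Definition truncation_kernel (K : set A) : Prop :=
  exists (B : truncType) (f : A -> B),
    truncation_morphism f /\ K = [set x | f x = 0].

(* The order inherited from [set A] is inclusion. *)
Record KA := TruncationKernel {
  KA_val :> set A;
  _ : `[< truncation_kernel KA_val >] }.

HB.instance Definition _ := [isSub for KA_val].
HB.instance Definition _ := [Choice of KA by <:].
HB.instance Definition _ := [SubChoice_isSubPOrder of KA by <: with set_display].

Definition generated_kernel (B : set A) : set A := smallest truncation_kernel B.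

(* The join in [KA] of a family of kernels is the kernel generated by its
   union; here the family consists of the polars of a (-) s for 0 < s < r. *)
Definition btl (a : A) (r : rat) : set A :=
  generated_kernel (\bigcup_(s in [set s : rat | 0 < s < r])
                      polar [set ominus a s]).

Definition truncA : set A := [set trunc a | a in [set a : A | 0 <= a]].

Definition spectral_filter : set KA :=
  generated_filter
    [set K : KA | exists2 a, truncA a & (K : set A) = btl a 1].

Definition spectral_frame := two_F spectral_filter.

HB.instance Definition _ := Order.POrder.on spectral_frame.

End Spectrum.

(* Main.v *)
Require Import Defs.
From HB Require Import structures.
From mathcomp Require Import all_boot all_order all_algebra.
From mathcomp Require Import ring generic_quotient ring_quotient.
From mathcomp Require Import boolp classical_sets cardinality.

Set Implicit Arguments.
Unset Strict Implicit.
Unset Printing Implicit Defensive.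

Import Order.TTheory GRing.Theory Num.Theory.
Local Open Scope classical_set_scope.
Local Open Scope ring_scope.

(** Given (T1)-(T3), axiom (T4) says exactly that the group is archimedean
    ([trunc_archimedean], [archimedean_T4]). Hence [K] is a truncation kernel iff
    it is a convex l-subgroup modulo which (T2), (T3) and the archimedean property
    hold ([truncation_kernelP]); one implication is the construction of the
    quotient [A / K]. This description is a list of closure conditions
    ([trunc_ideal]) on which the rest depends in two ways.

    - The conditions are stable under passing from [M] to
      [{x | M (|x| /\ k)}]. Intersections of such sets are the relative
      pseudocomplements, so [KA] is a frame, and polars are kernels.

    - Each condition has countably many premises, so an element of a join of
      kernels lies in the join of countably many of them
      ([countable_generation]).

    For the rest, think of the elements of [A] as real functions, of [bar a] as
    [a /\ 1], and of [a (-) r] as [(a - r)^+]. If [r < s], the regions [a > r] and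
    [a < s] cover the space; accordingly a kernel that contains [a (-) r] and the
    polar of [a (-) s] is everything ([trunc_ideal_total]). On the other hand
    [b - bar b = b (-) 1] lives where [b > 1], and is disjoint from the member
    [bar b <| 1] of the filter [F], writing [<|] for [btl]
    ([generated_cotrunc_btl]). Three consequences follow.

    - If [a >= 0] is in the kernel [x], then [[n a - bar (n a)]] is rather below
      [x], with witness [bar (n a) <| 1] in [F]. By (T3) these kernels generate
      [a]; this is regularity at the elements [(false, x)].

    - The kernels [a <| 1] with [a = bar c] form a base of [F]
      ([spectral_filter_base]), and [bar (2 a) <| 1] is rather below [a <| 1];
      this is regularity at the elements [(true, x)].

    - In a cover of the top of [2_F KA] some member [(true, x)] occurs, and [x]
      contains some [a <| 1]. Then [x] and [a] generate everything, and [a] lies in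
      the join of countably many members of the cover. *)

(** * Countable sets *)

Lemma countable_image (T U : Type) (f : T -> U) (X : set T) :
  countable X -> countable (f @` X).
Proof. exact: card_le_trans (card_image_le f X). Qed.

Lemma countable_setU (T : Type) (X Y : set T) :
  countable X -> countable Y -> countable (X `|` Y).
Proof.
move=> cX cY; rewrite -(@bigcup2E T X Y).
apply: bigcup_countable => [|i _]; first exact: countableP.
by case: i => [|[|i]] //=; apply: countable0.
Qed.

(** * Frames as ordered sets *)

Section FrameTheory.
Context {d : Order.disp_t} {L : porderType d}.
Implicit Types (x y z s t : L) (S : set L).

Lemma supremumsP S s :
  supremums S s <-> forall u, (s <= u)%O <-> ubound S u.
Proof.
split=> [[ubs leS] u|H].
  split=> [su y Sy|]; last exact: leS.
  exact: le_trans (ubs _ Sy) su.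
by split=> [|u /H //]; apply/H.
Qed.

Lemma infimumsP S m :
  infimums S m <-> forall u, (u <= m)%O <-> lbound S u.
Proof.
split=> [[lbm geS] u|H].
  split=> [um y Sy|]; last exact: geS.
  exact: le_trans um (lbm _ Sy).
by split=> [|u /H //]; apply/H.
Qed.

Lemma is_meetP x y m :
  is_meet x y m <-> forall u, (u <= m)%O = (u <= x)%O && (u <= y)%O.
Proof.
rewrite /is_meet infimumsP; split=> H u.
  apply/idP/andP => [/H lb|[ux uy]]; first by split; apply: lb; [left|right].
  by apply/H => z [->|->].
rewrite H; split=> [/andP[ux uy] z [->|->] //|lb].
by apply/andP; split; apply: lb; [left|right].
Qed.

Lemma is_joinP x y j :
  is_join x y j <-> forall u, (j <= u)%O = (x <= u)%O && (y <= u)%O.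
Proof.
rewrite /is_join supremumsP; split=> H u.
  apply/idP/andP => [/H ub|[xu yu]]; first by split; apply: ub; [left|right].
  by apply/H => z [->|->].
rewrite H; split=> [/andP[xu yu] z [->|->] //|ub].
by apply/andP; split; apply: ub; [left|right].
Qed.

Hypothesis frameL : is_frame L.

Lemma frame_top : exists t : L, is_top t.
Proof.
by have [/(_ setT)[t [ubt _]] _ _] := frameL; exists t.
Qed.

Lemma frame_bot : exists b : L, is_bot b.
Proof.
have [/(_ set0)[b [_ leb]] _ _] := frameL; exists b => y _.
by apply: leb => ?.
Qed.

(** Meet [x \/ z = T] with [y]: [y = (y /\ x) \/ (y /\ z) = y /\ x]. *)
Lemma rather_below_le y x : rather_below y x -> (y <= x)%O.
Proof.
case=> z [b [t [botb topt /is_meetP yzb /[dup] xzt [_ _]]]].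
have [_ _ /(_ y _ _ y xzt)[|_ ->//]] := frameL.
  by apply/is_meetP => u; case: (boolP (u <= y)%O) => //= _; rewrite topt.
move=> w [v /= [->|->] /is_meetP Hw].
  by have := lexx w; rewrite Hw => /andP[].
have -> : w = b; last exact: botb.
by apply: le_anti; rewrite yzb -Hw lexx /= Hw -yzb lexx.
Qed.

End FrameTheory.

(** * The frame [2_F L] *)

Section TwoFrame.
Context {d : Order.disp_t} {L : porderType d} {F : set L}.
Hypotheses (frameL : is_frame L) (filterF : lattice_filter F).
Implicit Types (p q u : two_F F) (x y z : L).

Local Notation lvl p := (two_F_val p).1.
Local Notation pt p := (two_F_val p).2.

Definition two_F_mk (e : bool) x (eF : e = true -> F x) : two_F F :=
  @TwoF d L F (e, x) (asboolT eF).

Lemma two_FP p : lvl p = true -> F (pt p).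
Proof. by case: p => p /= /asboolP. Qed.

Lemma le_two_F p q : (p <= q)%O = (lvl p ==> lvl q) && (pt p <= pt q)%O.
Proof.
by rewrite -Order.le_val leEprod leEbool /=; case: (lvl p); case: (lvl q).
Qed.

Lemma filter_up x y : F x -> (x <= y)%O -> F y.
Proof. by have [_ _ up] := filterF; apply: up. Qed.

(** Joins are computed componentwise: if some first component is [true], the
    second component of the join is above a member of [F]. *)
Lemma two_F_sup (S : set (two_F F)) j :
  supremums [set pt p | p in S] j ->
  exists2 s : two_F F, supremums S s &
    (lvl s = true -> exists2 p, S p & lvl p) /\ pt s = j.
Proof.
move=> [ubj lej].
have jF : `[< exists2 p, S p & lvl p >] = true -> F j.
  move=> /asboolP[p Sp p1]; apply: filter_up (two_FP p1) _.
  by apply: ubj; exists p.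
exists (two_F_mk jF); last by split=> // /asboolP.
split=> [p Sp|u ubu]; rewrite le_two_F /=; apply/andP; split.
- by apply/implyP => p1; apply/asboolP; exists p.
- by apply: ubj; exists p.
- by apply/implyP => /asboolP[p /ubu]; rewrite le_two_F => /andP[/implyP].
- by apply: lej => _ [p /ubu + <-]; rewrite le_two_F => /andP[].
Qed.

Lemma two_F_meet p q x : is_meet (pt p) (pt q) x ->
  exists2 m : two_F F, is_meet p q m & lvl m = lvl p && lvl q /\ pt m = x.
Proof.
move=> pqx; have mF : lvl p && lvl q = true -> F x.
  move=> /andP[p1 q1]; have [_ meetF _] := filterF.
  by apply: meetF pqx; apply: two_FP.
exists (two_F_mk mF) => //; apply/is_meetP => u; rewrite !le_two_F /=.
by move/is_meetP: pqx => ->; case: (lvl u); case: (lvl p); case: (lvl q);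
  rewrite //= ?andbF.
Qed.

Lemma two_F_frame : is_frame (two_F F).
Proof.
have [supL meetL distL] := frameL; split.
- move=> S; have [j /two_F_sup[s Ss _]] := supL [set pt p | p in S].
  by exists s.
- move=> p q; have [x /two_F_meet[m pqm _]] := meetL (pt p) (pt q).
  by exists m.
- move=> a S s m Ss /[dup] asm /is_meetP Hm.
  split=> [p [x Sx /is_meetP Hp]|u ubu].
    rewrite Hm; have := lexx p; rewrite {1}Hp => /andP[-> px] /=.
    by apply: le_trans px _; case: Ss => ub _; apply: ub.
  have {}ubu p : S p -> exists2 q : two_F F, (q <= u)%O &
      lvl q = lvl a && lvl p /\ is_meet (pt a) (pt p) (pt q).
    move=> Sp; have [x apx] := meetL (pt a) (pt p).
    have [q apq [q1 q2]] := two_F_meet apx.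
    by exists q; [apply: ubu; exists p|rewrite q2].
  have [j Sj] := supL [set pt p | p in S].
  have [s' Ss' [s'1 s'2]] := two_F_sup Sj.
  have ss' : (s <= s')%O by case: Ss => _; apply; case: Ss'.
  have [x asx] := meetL (pt a) j.
  have := lexx m; rewrite Hm => /andP[ma ms].
  have := le_trans ms ss'; rewrite !le_two_F in ma *.
  move: ma => /andP[/implyP ma1 ma2] /andP[/implyP ms1 ms2].
  apply/andP; split.
    apply/implyP => m1; have [p Sp p1] := s'1 (ms1 m1).
    have [q + [q1 _]] := ubu p Sp.
    by rewrite le_two_F q1 p1 ma1 //= => /andP[].
  rewrite s'2 in ms2.
  apply: (@le_trans _ _ x); first by move/is_meetP: asx => ->; rewrite ma2.
  have [_ ->//] := distL _ _ _ _ Sj asx.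
  move=> y [_ [p Sp <-] /is_meetP apy].
  have [q + [_ /is_meetP apq]] := ubu p Sp.
  rewrite le_two_F => /andP[_]; apply: le_trans.
  by rewrite apq -apy.
Qed.

Lemma two_F_topP (t : two_F F) : is_top t <-> lvl t /\ is_top (pt t).
Proof.
split=> [topt|[t1 topt] p _]; last first.
  by rewrite le_two_F t1 implybT topt.
have [x topx] := frame_top frameL.
have xF : true = true -> F x by have [topF _ _] := filterF => _; apply: topF.
have := topt (two_F_mk xF) I; rewrite le_two_F /= => /andP[-> xt]; split=> //.
by move=> y _; apply: le_trans xt; apply: topx.
Qed.

Lemma two_F_rather_below p q (w : two_F F) b t :
  is_bot b -> is_top t -> is_meet (pt p) (pt w) b -> is_join (pt q) (pt w) t ->
  lvl p && lvl w = false -> lvl q || lvl w -> rather_below p q.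
Proof.
move=> botb topt /two_F_meet[m pwm [m1 m2]] /is_joinP qwt pw1 qw1.
have tF : true = true -> F t by have [topF _ _] := filterF => _; apply: topF.
exists w, m, (two_F_mk tF); split=> //.
- by move=> u _; rewrite le_two_F m1 pw1 m2 botb.
- by apply/two_F_topP.
apply/is_joinP => u; rewrite !le_two_F /= qwt.
by case: (lvl u); case: (lvl q) qw1; case: (lvl w); rewrite //= ?andbF.
Qed.

(** A witness for [(e, y)] rather below [(false, x)] must have first component
    [true], because its join with [(false, x)] is the top; so its second component
    has to be in [F]. Below [(true, x)] a single element of the form [(true, y)]
    suffices, since [(false, x)] is already a join of elements rather below. *)
Lemma two_F_regular :
  (forall x, supremums [set y | exists w b t,
     [/\ F w, is_bot b, is_top t, is_meet y w b & is_join x w t]] x) ->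
  (forall x, F x -> exists2 y, F y & rather_below y x) ->
  regular_frame (two_F F).
Proof.
move=> regL regF p; split=> [q|u ubu].
  by apply: rather_below_le; apply: two_F_frame.
have [b botb] := frame_bot frameL.
rewrite le_two_F; apply/andP; split.
  apply/implyP => /[dup] p1 /two_FP/regF[y Fy [w [b' [t [bb' tt yw pw]]]]].
  have yF : true = true -> F y by [].
  have wF : false = true -> F w by [].
  have : rather_below (two_F_mk yF) p.
    by apply: (two_F_rather_below (w := two_F_mk wF) bb' tt) => //; rewrite p1.
  by move=> /ubu; rewrite le_two_F => /andP[].
have [_] := regL (pt p); apply=> y [w [b' [t [Fw bb' tt yw pw]]]].
have yF : false = true -> F y by [].
have wF : true = true -> F w by [].
have : rather_below (two_F_mk yF) p.
  by apply: (two_F_rather_below (w := two_F_mk wF) bb' tt) => //=; rewrite orbT.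
by move=> /ubu; rewrite le_two_F => /andP[].
Qed.

(** A cover of the top contains some [(true, x)], as otherwise [(false, T)] would
    be an upper bound; the criterion then covers what [x] leaves. *)
Lemma two_F_lindelof :
  (forall x S t, F x -> is_top t -> supremums S t ->
    exists S0 : set L,
      [/\ S0 `<=` S, countable S0 & supremums (x |` S0) t]) ->
  lindelof_frame (two_F F).
Proof.
move=> linL S t /[dup] topt /two_F_topP[t1 topt2] [ubt leS].
have [p0 Sp0 p01] : exists2 p, S p & lvl p.
  apply: contrapT => noS.
  have tF : false = true -> F (pt t) by [].
  have : (t <= two_F_mk tF)%O.
    apply: leS => p Sp; rewrite le_two_F /=; apply/andP; split.
      by apply/implyP => p1; case: noS; exists p.
    by have := ubt _ Sp; rewrite le_two_F => /andP[].
  by rewrite le_two_F t1.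
have supS : supremums [set pt p | p in S] (pt t).
  split=> [y _|u ubu]; first exact: topt2.
  have uF : true = true -> F u.
    by move=> _; apply: filter_up (two_FP p01) _; apply: ubu; exists p0.
  have : (t <= two_F_mk uF)%O.
    apply: leS => p Sp; rewrite le_two_F /= implybT /=.
    by apply: ubu; exists p.
  by rewrite le_two_F => /andP[].
have [S0 [S0S countS0 [_ leS0]]] := linL _ _ _ (two_FP p01) topt2 supS.
have [g gP] : {g : L -> two_F F & forall y, S0 y -> S (g y) /\ pt (g y) = y}.
  apply: (@choice _ _ (fun y q => S0 y -> S q /\ pt q = y)) => y.
  have [/S0S[q Sq <-]|nS0] := pselect (S0 y); first by exists q.
  by exists p0.
exists (p0 |` (g @` S0)); split.
- by move=> _ [->//|[y /gP[Sy _] <-]].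
- exact: countable_setU (countable1 _) (countable_image _ countS0).
split=> [p _|u ubu]; first exact: topt.
have := ubu _ (or_introl erefl); rewrite !le_two_F p01 /= => /andP[-> p0u].
rewrite implybT /=; apply: leS0 => y [->//|/[dup] S0y /gP[_ <-]].
have : (g y <= u)%O by apply: ubu; right; exists y.
by rewrite le_two_F => /andP[].
Qed.

End TwoFrame.

(** * Lattice-ordered groups and rational multiples *)

Definition lpos {A : lgroupType} (x : A) : A := ljoin x 0.

Section LGroupTheory.
Context {A : lgroupType}.
Implicit Types (x y z t : A) (n m : nat) (q r : rat).

Lemma lgD2r z x y : (x + z <= y + z) = (x <= y).
Proof.
apply/idP/idP => [|/(lgroup_leD2r z)//].
by move=> /(lgroup_leD2r (- z)); rewrite !addrK.
Qed.

Lemma lgD2l z x y : (z + x <= z + y) = (x <= y).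
Proof. by rewrite ![z + _]addrC lgD2r. Qed.

Lemma lgD x y z t : x <= y -> z <= t -> x + z <= y + t.
Proof. by move=> xy zt; apply: (@le_trans _ _ (y + z)); rewrite ?lgD2r ?lgD2l. Qed.

Lemma lgBlD x y z : (x - y <= z) = (x <= z + y).
Proof. by rewrite -(lgD2r y (x - y)) subrK. Qed.

Lemma lgBrD x y z : (x <= y - z) = (x + z <= y).
Proof. by rewrite -(lgD2r z _ (y - z)) subrK. Qed.

Lemma lgsubr_ge0 x y : (0 <= x - y) = (y <= x).
Proof. by rewrite lgBrD add0r. Qed.

Lemma lgN2 x y : (- x <= - y) = (y <= x).
Proof. by rewrite -(lgD2r (x + y) (- x)) addKr addrC addrK. Qed.

Lemma lgN_le0 x : (- x <= 0) = (0 <= x).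
Proof. by rewrite -{1}oppr0 lgN2. Qed.

Lemma lgB_le x y : (x - y <= x) = (0 <= y).
Proof. by rewrite -{2}[x]addr0 lgD2l lgN_le0. Qed.

Lemma lgaddr_ge0 x y : 0 <= x -> 0 <= y -> 0 <= x + y.
Proof. by move=> x0 y0; rewrite -[0]addr0 lgD. Qed.

Lemma lg_leDr x y : (x <= x + y) = (0 <= y).
Proof. by rewrite -{1}[x]addr0 lgD2l. Qed.

Lemma lgmuln_ge0 x n : 0 <= x -> 0 <= x *+ n.
Proof. by move=> x0; elim: n => [|n IH]; rewrite ?mulr0n// mulrS lgaddr_ge0. Qed.

Lemma lgmuln_le x y n : x <= y -> x *+ n <= y *+ n.
Proof. by move=> xy; rewrite -lgsubr_ge0 -mulrnBl lgmuln_ge0// lgsubr_ge0. Qed.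

Lemma lgmuln_leS x n m : 0 <= x -> (n <= m)%N -> x *+ n <= x *+ m.
Proof. by move=> x0 nm; rewrite -(subnK nm) mulrnDr addrC lg_leDr lgmuln_ge0. Qed.

Lemma lgle_muln x n : 0 <= x -> (0 < n)%N -> x <= x *+ n.
Proof. by move=> x0 n0; rewrite -{1}[x]mulr1n lgmuln_leS. Qed.

Lemma lmeet_lel x y : lmeet x y <= x.
Proof. by have := lexx (lmeet x y); rewrite le_lmeet => /andP[]. Qed.

Lemma lmeet_ler x y : lmeet x y <= y.
Proof. by have := lexx (lmeet x y); rewrite le_lmeet => /andP[]. Qed.

Lemma ljoin_gel x y : x <= ljoin x y.
Proof. by have := lexx (ljoin x y); rewrite ljoin_le => /andP[]. Qed.

Lemma ljoin_ger x y : y <= ljoin x y.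
Proof. by have := lexx (ljoin x y); rewrite ljoin_le => /andP[]. Qed.

#[local] Hint Resolve lmeet_lel lmeet_ler ljoin_gel ljoin_ger : core.

Lemma lmeetC x y : lmeet x y = lmeet y x.
Proof. by apply: le_anti; rewrite !le_lmeet !lmeet_lel !lmeet_ler. Qed.

Lemma lmeet_mono x y z t : x <= y -> z <= t -> lmeet x z <= lmeet y t.
Proof.
move=> xy zt; rewrite le_lmeet (le_trans (lmeet_lel _ _) xy).
exact: le_trans (lmeet_ler _ _) zt.
Qed.

Lemma lmeet_l x y : x <= y -> lmeet x y = x.
Proof. by move=> xy; apply: le_anti; rewrite lmeet_lel le_lmeet lexx. Qed.

Lemma lmeetxx x : lmeet x x = x. Proof. exact: lmeet_l. Qed.

Lemma lmeet_ge0 x y : 0 <= x -> 0 <= y -> 0 <= lmeet x y.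
Proof. by rewrite le_lmeet => -> ->. Qed.

Lemma ljoin_l x y : y <= x -> ljoin x y = x.
Proof. by move=> xy; apply: le_anti; rewrite ljoin_gel ljoin_le lexx xy. Qed.

Lemma lposP x y : (lpos x <= y) = (x <= y) && (0 <= y).
Proof. exact: ljoin_le. Qed.

Lemma lpos_ge0 x : 0 <= lpos x. Proof. exact: ljoin_ger. Qed.
Lemma lpos_ge x : x <= lpos x. Proof. exact: ljoin_gel. Qed.
Lemma lpos_id x : 0 <= x -> lpos x = x. Proof. exact: ljoin_l. Qed.
Lemma lpos_mono x y : x <= y -> lpos x <= lpos y.
Proof. by move=> xy; rewrite lposP lpos_ge0 (le_trans xy (lpos_ge _)). Qed.

(** Subtraction of [x /\ y] turns statements on meets into statements on positive
    parts, which is how disjoint elements arise below. *)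
Lemma lsub_lmeet x y : x - lmeet x y = lpos (x - y).
Proof.
apply: le_anti; apply/andP; split.
  rewrite lgBlD addrC -lgBlD le_lmeet lgB_le lpos_ge0 /=.
  by rewrite lgBlD addrC -lgBlD lpos_ge.
by rewrite lposP lgD2l lgN2 lmeet_ler lgsubr_ge0 lmeet_lel.
Qed.

Lemma lmeetBr x y z : lmeet (x - z) (y - z) = lmeet x y - z.
Proof.
apply: le_anti; rewrite le_lmeet !lgD2r lmeet_lel lmeet_ler andbT.
by rewrite lgBrD le_lmeet -!lgBrD lmeet_lel lmeet_ler.
Qed.

Lemma lpos_disjoint x y : lmeet (lpos (x - y)) (lpos (y - x)) = 0.
Proof. by rewrite -!lsub_lmeet [lmeet y x]lmeetC lmeetBr subrr. Qed.

Lemma lposBneg x : lpos x - lpos (- x) = x.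
Proof.
have := lsub_lmeet 0 x; rewrite !sub0r => <-.
have := lsub_lmeet x 0; rewrite subr0 => <-.
by rewrite opprK [lmeet 0 x]lmeetC subrK.
Qed.

Lemma lmeetDr x y z :
  0 <= x -> 0 <= y -> 0 <= z -> lmeet x (y + z) <= lmeet x y + lmeet x z.
Proof.
move=> x0 y0 z0; rewrite -lgBlD le_lmeet; apply/andP; split.
  apply: (le_trans _ (lmeet_lel x (y + z))).
  by rewrite lgB_le lmeet_ge0.
rewrite lgBlD [y + lmeet _ _]addrC -lgBlD le_lmeet; apply/andP; split.
  apply: (le_trans _ (lmeet_lel x (y + z))).
  by rewrite lgB_le.
by rewrite lgBlD [z + y]addrC lmeet_ler.
Qed.

Lemma lmeet_muln x y n :
  0 <= x -> 0 <= y -> lmeet x (y *+ n) <= lmeet x y *+ n.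
Proof.
move=> x0 y0; elim: n => [|n IH]; first by rewrite !mulr0n.
rewrite !mulrS; apply: le_trans (lmeetDr _ _ _) _ => //.
  exact: lgmuln_ge0.
by rewrite lgD2l.
Qed.

Lemma lmeet_muln_eq0 x y n :
  0 <= x -> 0 <= y -> lmeet x y = 0 -> lmeet x (y *+ n) = 0.
Proof.
move=> x0 y0 xy0; apply: le_anti; rewrite lmeet_ge0 ?lgmuln_ge0// andbT.
by have := lmeet_muln n x0 y0; rewrite xy0 mul0rn.
Qed.

Lemma lmeet_eq0_le x y z t :
  0 <= x -> 0 <= z -> x <= y -> z <= t -> lmeet y t = 0 -> lmeet x z = 0.
Proof.
move=> x0 z0 xy zt yt; apply: le_anti; rewrite lmeet_ge0// andbT -yt.
exact: lmeet_mono.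
Qed.

(** The positive and negative parts of [x] are disjoint, hence so are their
    multiples; if [n x >= 0] the negative one lies below the positive one, and
    is therefore zero. *)
Lemma lgmuln_ge0_inv x n : (0 < n)%N -> 0 <= x *+ n -> 0 <= x.
Proof.
move=> n0; rewrite -{1}[x]lposBneg mulrnBl lgsubr_ge0 => npos.
have disj : lmeet (lpos x) (lpos (- x)) = 0.
  by have := lpos_disjoint x 0; rewrite subr0 sub0r.
have : lmeet (lpos (- x) *+ n) (lpos x *+ n) = 0.
  apply: lmeet_muln_eq0; rewrite ?lgmuln_ge0 ?lpos_ge0// lmeetC.
  by rewrite lmeet_muln_eq0 ?lpos_ge0.
rewrite lmeet_l// => neg0.
have := lgle_muln (lpos_ge0 (- x)) n0; rewrite neg0 => neg_le0.
by rewrite -lgN_le0; apply: (le_trans _ neg_le0); apply: lpos_ge.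
Qed.

Lemma lgmuln_le_inv x y n : (0 < n)%N -> x *+ n <= y *+ n -> x <= y.
Proof.
move=> n0; rewrite -[x <= y]lgsubr_ge0 -[x *+ n <= _]lgsubr_ge0 -mulrnBl.
exact: lgmuln_ge0_inv.
Qed.

Lemma lgmuln_inj x y n : (0 < n)%N -> x *+ n = y *+ n -> x = y.
Proof.
move=> n0 xy; apply: le_anti.
by apply/andP; split; apply: (lgmuln_le_inv n0); rewrite xy.
Qed.

Lemma labs_le x y : (labs x <= y) = (x <= y) && (- x <= y).
Proof. exact: ljoin_le. Qed.

Lemma labs_ge x : x <= labs x. Proof. exact: ljoin_gel. Qed.
Lemma labs_geN x : - x <= labs x. Proof. exact: ljoin_ger. Qed.

Lemma labs_ge0 x : 0 <= labs x.
Proof.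
apply: (@lgmuln_ge0_inv _ 2) => //.
by rewrite mulr2n -(subrr x); apply: lgD; [apply: labs_ge|apply: labs_geN].
Qed.

Lemma labs_id x : 0 <= x -> labs x = x.
Proof.
by move=> x0; apply: ljoin_l; apply: (le_trans _ x0); rewrite lgN_le0.
Qed.

Lemma labsN x : labs (- x) = labs x.
Proof.
have le_labsN y : labs (- y) <= labs y.
  by rewrite labs_le opprK labs_ge labs_geN.
by apply: le_anti; rewrite le_labsN -{1}[x]opprK le_labsN.
Qed.

Lemma labsD x y : labs (x + y) <= labs x + labs y.
Proof. rewrite labs_le opprD; apply/andP; split; apply: lgD.
- exact: labs_ge.
- exact: labs_ge.
- exact: labs_geN.
- exact: labs_geN. Qed.

Lemma labs0 : labs 0 = 0 :> A. Proof. exact: labs_id. Qed.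

Lemma labs_eq0 x : labs x = 0 -> x = 0.
Proof.
move=> x0; apply: le_anti; apply/andP; split; first by rewrite -x0 labs_ge.
by rewrite -lgN_le0 -x0 labs_geN.
Qed.

Lemma lpos_le_labs x : lpos x <= labs x.
Proof. by rewrite lposP labs_ge labs_ge0. Qed.

Lemma lposD x y : lpos (x + y) <= lpos x + lpos y.
Proof. by rewrite lposP lgaddr_ge0 ?lpos_ge0// andbT; apply: lgD; exact: lpos_ge. Qed.

Lemma lpos_lmeet x y z :
  lpos (z - lmeet x y) = ljoin (lpos (z - x)) (lpos (z - y)).
Proof.
apply: le_anti; apply/andP; split; last first.
  by rewrite ljoin_le !lpos_mono// lgD2l lgN2 ?lmeet_lel ?lmeet_ler.
rewrite lposP (le_trans (lpos_ge0 (z - x)) (ljoin_gel _ _)) andbT.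
have swap (t u w : A) : (t - u <= w) = (t - w <= u) by rewrite lgBlD [RHS]lgBlD addrC.
rewrite swap le_lmeet 2!(swap z (ljoin _ _)).
rewrite (le_trans (lpos_ge _) (ljoin_gel _ _)).
by rewrite (le_trans (lpos_ge _) (ljoin_ger _ _)).
Qed.

Lemma ljoinN x y : ljoin x y = - lmeet (- x) (- y).
Proof.
apply: le_anti; rewrite ljoin_le -{1}[x]opprK -{2}[y]opprK !lgN2.
rewrite lmeet_lel lmeet_ler -[ljoin x y]opprK lgN2 le_lmeet !lgN2.
by rewrite ljoin_gel ljoin_ger.
Qed.

Lemma qscale_ex q x : exists y : A, y *~ denq q = x *~ numq q.
Proof.
have d0 : (0 < `|denq q|)%N by rewrite absz_gt0 denq_neq0.
have [y Hy] := @lgroup_divisible A _ (x *~ numq q) d0.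
by exists y; rewrite -Hy -absz_denq.
Qed.

Lemma qscaleE q x : qscale q x *~ denq q = x *~ numq q.
Proof.
rewrite /qscale; have [y Hy] := qscale_ex q x.
by case: xgetP => [z _ //|/(_ y)].
Qed.

Lemma lgmulz_inj (k : int) x y : k != 0 -> x *~ k = y *~ k -> x = y.
Proof.
case: k => n n0; first by apply: lgmuln_inj; rewrite lt0n.
by rewrite !NegzE !mulrNz => /oppr_inj; apply: lgmuln_inj.
Qed.

(** This computes [qscale] from any fraction, not only from the reduced one. *)
Lemma qscale_uniq (n k : int) q x y :
  k != 0 -> q = n%:Q / k%:Q -> y *~ k = x *~ n -> y = qscale q x.
Proof.
move=> k0 qE yx; have d0 := denq_neq0 q.
have nk : numq q * k = n * denq q.
  apply: (@intr_inj rat).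
  by rewrite !intrM numqE mulrAC {1}qE divfK// intr_eq0.
apply: (lgmulz_inj d0); apply: (lgmulz_inj k0).
by rewrite qscaleE -[RHS]mulrzA nk mulrzA -yx -!mulrzA mulrC.
Qed.

Lemma qscale1 x : qscale 1 x = x.
Proof. by symmetry; apply: (@qscale_uniq 1 1). Qed.

Lemma qscale0 x : qscale 0 x = 0.
Proof. by symmetry; apply: (@qscale_uniq 0 1); rewrite ?mul0r// mul0rz mulr0z. Qed.

Lemma qscale_nat n x : qscale n%:R x = x *+ n.
Proof. by symmetry; apply: (@qscale_uniq n 1); rewrite ?divr1. Qed.

Lemma qscaleM q r x : qscale q (qscale r x) = qscale (q * r) x.
Proof.
apply: (@qscale_uniq (numq q * numq r) (denq q * denq r)).
- by rewrite mulf_neq0 ?denq_neq0.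
- by rewrite !intrM invfM mulrACA !divq_num_den.
rewrite mulrzA qscaleE -mulrzA [numq q * denq r]mulrC [LHS]mulrzA qscaleE -mulrzA.
by rewrite mulrC.
Qed.

Lemma qscaleDr q x y : qscale q (x + y) = qscale q x + qscale q y.
Proof.
symmetry; apply: (@qscale_uniq (numq q) (denq q)).
- exact: denq_neq0.
- by rewrite divq_num_den.
by rewrite !mulrzDl !qscaleE.
Qed.

Lemma qscaleNr q x : qscale q (- x) = - qscale q x.
Proof.
symmetry; apply: (@qscale_uniq (numq q) (denq q)).
- exact: denq_neq0.
- by rewrite divq_num_den.
by rewrite !mulNrz !qscaleE.
Qed.

Lemma qscaleDl q r x : qscale (q + r) x = qscale q x + qscale r x.
Proof.
symmetry; apply: (@qscale_uniq (numq q * denq r + numq r * denq q)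
  (denq q * denq r)).
- by rewrite mulf_neq0 ?denq_neq0.
- rewrite intrD !intrM !numqE; field.
  by rewrite !intr_eq0 !denq_neq0.
rewrite mulrzDl mulrzDr; congr (_ + _); first by rewrite mulrzA qscaleE -mulrzA.
by rewrite [denq q * _]mulrC [LHS]mulrzA qscaleE -mulrzA.
Qed.

Lemma qscale_ge0 q x : 0 <= q -> 0 <= x -> 0 <= qscale q x.
Proof.
move=> q0 x0; apply: (@lgmuln_ge0_inv _ `|denq q|).
  by rewrite absz_gt0 denq_neq0.
have -> : qscale q x *+ `|denq q| = qscale q x *~ denq q.
  by rewrite -[in RHS]absz_denq.
rewrite qscaleE; have := q0; rewrite -numq_ge0.
by case: (numq q) => // n _; apply: lgmuln_ge0.
Qed.

Lemma qscale_le q x y : 0 <= q -> x <= y -> qscale q x <= qscale q y.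
Proof.
move=> q0 xy; rewrite -lgsubr_ge0 -qscaleNr -qscaleDr qscale_ge0//.
by rewrite lgsubr_ge0.
Qed.

Lemma qscaleK q x : q != 0 -> qscale q (qscale q^-1 x) = x.
Proof. by move=> q0; rewrite qscaleM divff// qscale1. Qed.

Lemma qscaleVK q x : q != 0 -> qscale q^-1 (qscale q x) = x.
Proof. by move=> q0; rewrite qscaleM mulVf// qscale1. Qed.

Lemma qscale_ler q r x : q <= r -> 0 <= x -> qscale q x <= qscale r x.
Proof.
move=> qr x0; rewrite -[r](subrK q) qscaleDl addrC lg_leDr.
by rewrite qscale_ge0// subr_ge0.
Qed.

Lemma qscale_le_nat q x : 0 <= x -> exists n, qscale q x <= x *+ n.
Proof.
move=> x0; exists (Num.bound `|q|); rewrite -qscale_nat qscale_ler//.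
exact: ltW (le_lt_trans (ler_norm q) (archi_boundP (normr_ge0 q))).
Qed.

End LGroupTheory.


(** * Consequences of (T1) *)

Section TruncationTheory.
Context {A : lgroupType}.

(** Positivity and (T1), kept apart from the other axioms because they already
    yield the estimates below, which serve for the quotients before these are
    known to be truncs. *)
Definition truncation (bar : A -> A) : Prop :=
  forall a, 0 <= a -> 0 <= bar a /\
    forall b, 0 <= b -> lmeet a (bar b) <= bar a /\ bar a <= a.

Variables (bar : A -> A) (barT : truncation bar).
Implicit Types (a b c z v w : A) (r s t : rat).
Local Notation ominus_ := (ominus_of bar).

Lemma bar_ge0 a : 0 <= a -> 0 <= bar a.
Proof. by move=> /barT[]. Qed.

Lemma bar_le a : 0 <= a -> bar a <= a.
Proof. by move=> a0; have [_ /(_ a a0)[]] := barT a0. Qed.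

(** The form in which (T1) is used: what lies below [a], and below some truncated
    element, lies below [bar a]. *)
Lemma le_bar z a w : 0 <= a -> 0 <= w -> z <= a -> z <= bar w -> z <= bar a.
Proof.
move=> a0 w0 za zw; have [_ /(_ w w0)[aw _]] := barT a0.
by apply: le_trans aw; rewrite le_lmeet za.
Qed.

Lemma bar_mono a b : 0 <= a -> a <= b -> bar a <= bar b.
Proof.
move=> a0 ab; have b0 := le_trans a0 ab.
by apply: (le_bar b0 a0) => //; apply: le_trans ab; apply: bar_le.
Qed.

Lemma bar0 : bar 0 = 0.
Proof. by apply: le_anti; rewrite bar_ge0// bar_le. Qed.

Lemma barB_le a b : 0 <= a -> 0 <= b -> bar a - bar b <= lpos (a - b).
Proof.
move=> a0 b0; apply: (@le_trans _ _ (bar a - lmeet (bar a) b)).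
  rewrite lgD2l lgN2; apply: (le_bar b0 a0); first exact: lmeet_ler.
  exact: lmeet_lel.
by rewrite lsub_lmeet; apply: lpos_mono; rewrite lgD2r bar_le.
Qed.

Lemma cobar_ge0 a : 0 <= a -> 0 <= a - bar a.
Proof. by move=> a0; rewrite lgsubr_ge0 bar_le. Qed.

Lemma cobar_mono a b : 0 <= a -> a <= b -> a - bar a <= b - bar b.
Proof.
move=> a0 ab; have b0 := le_trans a0 ab.
have := barB_le b0 a0; rewrite lpos_id ?lgsubr_ge0// => H.
rewrite lgBlD -addrA [- _ + _]addrC -[bar a - bar b]opprB lgBrD addrC.
by rewrite -lgBrD.
Qed.

Lemma cobar_le_lpos a b : 0 <= a -> 0 <= b -> a - bar a <= lpos (a - bar b).
Proof.
move=> a0 b0; rewrite -lsub_lmeet lgD2l lgN2.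
by apply: (le_bar a0 b0); [apply: lmeet_lel|apply: lmeet_ler].
Qed.

Lemma ominus_of_scale a r : r != 0 ->
  ominus_ a r = qscale r (qscale r^-1 a - bar (qscale r^-1 a)).
Proof. by move=> r0; rewrite qscaleDr qscaleNr qscaleK. Qed.

Lemma ominus_of_ge0 a r : 0 <= r -> 0 <= a -> 0 <= ominus_ a r.
Proof.
rewrite le0r => /orP[/eqP->|r0] a0; first by rewrite /ominus_of qscale0 subr0.
rewrite lgsubr_ge0 -{2}[a](@qscaleK _ r) ?lt0r_neq0// qscale_le ?(ltW r0)//.
by rewrite bar_le// qscale_ge0// invr_ge0 ltW.
Qed.

(** With [bar v, bar w <= 1], the conclusion reads [z <= a /\ (r + t)]. Both
    [bar v] and [bar w] are below [bar (v \/ w)], so that after division by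
    [r + t] this is (T1). *)
Lemma le_qscale_bar z a v w r t :
  0 <= a -> 0 <= v -> 0 <= w -> 0 <= r -> 0 <= t -> 0 < r + t -> z <= a ->
  z <= qscale r (bar v) + qscale t (bar w) ->
  z <= qscale (r + t) (bar (qscale (r + t)^-1 a)).
Proof.
move=> a0 v0 w0 r0 t0 s0 za zvw; have sN0 := lt0r_neq0 s0.
have vw0 : 0 <= ljoin v w by apply: le_trans v0 (ljoin_gel _ _).
rewrite -[z](qscaleK _ sN0) qscale_le ?(ltW s0)//.
apply: (@le_bar _ _ (ljoin v w)) => //.
- by rewrite qscale_ge0// invr_ge0 ltW.
- by rewrite qscale_le// invr_ge0 ltW.
rewrite -[bar (ljoin v w)](qscaleVK _ sN0) qscale_le ?invr_ge0 ?(ltW s0)//.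
apply: le_trans zvw _; rewrite qscaleDl.
by apply: lgD; apply: qscale_le => //; apply: bar_mono => //;
  [apply: ljoin_gel|apply: ljoin_ger].
Qed.

(** Where [a > s] one has [a - s <= (a - r) - (s - r) bar b], as [bar b <= 1]. *)
Lemma ominus_of_le a b r s : 0 <= a -> 0 <= b -> 0 <= r -> r < s ->
  ominus_ a s <= lpos (ominus_ a r - qscale (s - r) (bar b)).
Proof.
move=> a0 b0 r0 rs; rewrite /ominus_of -addrA -opprD -lsub_lmeet lgD2l lgN2.
have := @le_qscale_bar (lmeet a (qscale r (bar (qscale r^-1 a)) +
  qscale (s - r) (bar b))) a (qscale r^-1 a) b r (s - r) a0.
rewrite [r + _]addrC subrK; apply.
- by rewrite qscale_ge0// invr_ge0.
- exact: b0.
- exact: r0.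
- by rewrite subr_ge0 ltW.
- exact: le_lt_trans rs.
- exact: lmeet_lel.
- exact: lmeet_ler.
Qed.

(** [c] vanishes except where [b > 1]; there [bar b] is 1 and [bar b (-) s] is
    [1 - s]. *)
Lemma qscale_bar_le_ominus_bar b c s : 0 <= b -> 0 <= c -> 0 < s < 1 ->
  c <= b - bar b -> qscale (1 - s) (bar c) <= ominus_ (bar b) s.
Proof.
move=> b0 c0 /andP[s0 s1] cb; have bb0 := bar_ge0 b0.
have bs0 : 0 <= qscale s^-1 (bar b) by rewrite qscale_ge0// invr_ge0 ltW.
rewrite lgBrD.
have := @le_qscale_bar (qscale (1 - s) (bar c) +
  qscale s (bar (qscale s^-1 (bar b)))) b c (qscale s^-1 (bar b)) (1 - s) s b0.
rewrite subrK invr1 !qscale1; apply=> //.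
- by rewrite subr_ge0 ltW.
- exact: ltW.
rewrite -[leRHS](subrK (bar b)); apply: lgD.
  apply: le_trans cb; apply: le_trans (bar_le c0).
  rewrite -[leRHS]qscale1 qscale_ler ?bar_ge0//.
  by rewrite gerBl ltW.
rewrite -{2}[bar b](@qscaleK _ s) ?lt0r_neq0// qscale_le ?(ltW s0)//.
exact: bar_le.
Qed.

(** Let [x] lie in all the sets of (T4). As [bar |x| <= 1], the element
    [(bar |x| - a / n)^+] is disjoint from [a (-) n], hence from [x], although it is
    at most [|x|]: it is zero. So [n bar |x| <= a] for all [n]. *)
Lemma archimedean_T4 :
  (forall a : A, 0 <= a -> bar a = 0 -> a = 0) ->
  (forall a b : A, 0 <= a -> 0 <= b -> (forall n, a *+ n <= b) -> a = 0) ->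
  forall a : A, 0 <= a ->
  \bigcap_(n in [set n : nat | (0 < n)%N])
    polar (polar [set ominus_of bar a n%:R]) = [set 0].
Proof.
move=> bar_eq0 arch a a0; apply/seteqP; split=> [x Hx|_ -> n _ b _].
  apply: labs_eq0; apply: bar_eq0; first exact: labs_ge0.
  have bx0 : 0 <= bar (labs x) by apply: bar_ge0 => //; exact: labs_ge0.
  apply: (arch _ a) => // -[|n]; first by rewrite mulr0n.
  have nQ0 : n.+1%:R != 0 :> rat by rewrite pnatr_eq0.
  rewrite -[leRHS](qscaleK _ nQ0) qscale_nat; apply: lgmuln_le.
  set c := qscale _ a; have c0 : 0 <= c by rewrite qscale_ge0// invr_ge0.
  set y := lpos (bar (labs x) - c).
  have y_polar : polar [set ominus_of bar a n.+1%:R] y.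
    move=> _ ->; rewrite ominus_of_scale// qscale_nat -/c.
    have cc0 := cobar_ge0 c0.
    rewrite !labs_id ?lpos_ge0 ?lgmuln_ge0// lmeet_muln_eq0 ?lpos_ge0//.
    apply: lmeet_eq0_le (lpos_disjoint (bar (labs x)) c) => //.
      exact: lpos_ge0.
    by apply: cobar_le_lpos => //; exact: labs_ge0.
  have := Hx n.+1 isT y y_polar; rewrite (labs_id (lpos_ge0 _)) lmeetC lmeet_l.
    by move=> y0; rewrite -lgsubr_ge0 -lgN_le0 opprB -y0 lpos_ge.
  rewrite lposP labs_ge0 andbT; apply: le_trans (bar_le (labs_ge0 x)).
  by rewrite lgB_le.
by rewrite labs0 lmeet_l// labs_ge0.
Qed.

End TruncationTheory.

(** * Truncation kernels as ideals *)

Section TruncTheory.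
Context {A : truncType}.
Implicit Types (a b x y : A) (n : nat).

Lemma trunc_truncation : truncation (@trunc A).
Proof.
by move=> a a0; split; [exact: trunc_ge0|move=> b b0; exact: truncT1].
Qed.

(** Let [n a <= b] for all [n]. For [y] disjoint from [b (-) n], every multiple of
    [a] is at most [b / n], hence at most 1, where [y] is nonzero; (T3) then gives
    [a /\ y = 0]. So [a] lies in all the sets of (T4). *)
Lemma trunc_archimedean a b :
  0 <= a -> 0 <= b -> (forall n, a *+ n <= b) -> a = 0.
Proof.
move=> a0 b0 nab; have /seteqP[sub0 _] := truncT4 b b0.
apply: sub0 => n /= n0 y /(_ _ erefl).
have nQ0 : n%:R != 0 :> rat by rewrite pnatr_eq0 -lt0n.
have ban0 : 0 <= qscale n%:R^-1 b by rewrite qscale_ge0// invr_ge0.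
set g := qscale n%:R^-1 b - trunc (qscale n%:R^-1 b).
have g0 : 0 <= g by apply: cobar_ge0 => //; exact: trunc_truncation.
rewrite ominus_of_scale// -/g qscale_nat.
rewrite [labs (g *+ n)]labs_id ?lgmuln_ge0// => yg0.
rewrite (labs_id a0); have y0 := labs_ge0 y.
apply: truncT3 => [|m m0]; first exact: lmeet_ge0.
set c := lmeet a (labs y); have c0 : 0 <= c by exact: lmeet_ge0.
apply/eqP; rewrite -subr_eq0; apply/eqP.
set e := _ - _; have e0 : 0 <= e.
  by apply: (cobar_ge0 trunc_truncation); exact: lgmuln_ge0.
rewrite -(lmeetxx e); apply: (@lmeet_eq0_le _ e (labs y *+ m) e (g *+ n)) => //.
- apply: le_trans (lgmuln_le m (lmeet_ler a (labs y))).
  by rewrite lgB_le trunc_ge0// lgmuln_ge0.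
- apply: le_trans (lgle_muln g0 n0).
  apply: (cobar_mono trunc_truncation); first exact: lgmuln_ge0.
  apply: (@lgmuln_le_inv _ _ _ n) => //.
  rewrite -(qscale_nat n (qscale _ _)) qscaleK// -mulrnA.
  apply: le_trans (nab (m * n)%N); apply: lgmuln_le; exact: lmeet_lel.
rewrite lmeetC lmeet_muln_eq0 ?lgmuln_ge0//.
by rewrite lmeetC.
Qed.

(** The first three conditions define the convex l-subgroups; the others say that
    (T2), (T3) and the archimedean property hold modulo [K]. *)
Record trunc_ideal (K : set A) : Prop := TruncIdeal {
  trunc_ideal0 : K 0;
  trunc_idealB : forall x y, K x -> K y -> K (x - y);
  trunc_ideal_solid : forall x y, K y -> labs x <= labs y -> K x;
  trunc_ideal_trunc : forall a, 0 <= a -> K (trunc a) -> K a;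
  trunc_ideal_cotrunc : forall a, 0 <= a ->
    (forall n, (0 < n)%N -> K (a *+ n - trunc (a *+ n))) -> K a;
  trunc_ideal_arch : forall a b, 0 <= a -> 0 <= b ->
    (forall n, K (lpos (a *+ n - b))) -> K a }.

Section Ideal.
Context {K : set A}.
Hypothesis idK : trunc_ideal K.

Lemma trunc_idealN x : K x -> K (- x).
Proof. by move=> Kx; rewrite -sub0r; apply: trunc_idealB => //; case: idK. Qed.

Lemma trunc_idealD x y : K x -> K y -> K (x + y).
Proof.
by move=> Kx Ky; rewrite -[y]opprK; apply: trunc_idealB => //; apply: trunc_idealN.
Qed.

Lemma trunc_ideal_le x y : 0 <= x -> x <= y -> K y -> K x.
Proof.
move=> x0 xy Ky; apply: (trunc_ideal_solid idK Ky).
by rewrite !labs_id// (le_trans x0).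
Qed.

Lemma trunc_ideal_labs x : K (labs x) <-> K x.
Proof.
by split=> Kx; apply: (trunc_ideal_solid idK Kx); rewrite [labs (labs x)]labs_id ?labs_ge0.
Qed.

Lemma trunc_ideal_lpos x : K x -> K (lpos x).
Proof.
move=> /trunc_ideal_labs; apply: trunc_ideal_le; first exact: lpos_ge0.
exact: lpos_le_labs.
Qed.

Lemma trunc_ideal_muln x n : K x -> K (x *+ n).
Proof.
move=> Kx; elim: n => [|n IH]; first by case: idK.
by rewrite mulrS; apply: trunc_idealD.
Qed.

Lemma trunc_ideal_qscale q x : 0 <= q -> 0 <= x -> K x -> K (qscale q x).
Proof.
move=> q0 x0 Kx; have [n le_n] := qscale_le_nat q x0.
by apply: trunc_ideal_le le_n (trunc_ideal_muln n Kx); apply: qscale_ge0.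
Qed.

Lemma trunc_ideal_qscaleV q x : 0 < q -> 0 <= x -> K (qscale q x) -> K x.
Proof.
move=> q0 x0 Kx; rewrite -(@qscaleVK _ q x) ?lt0r_neq0//.
have qK := ltW q0.
by apply: trunc_ideal_qscale => //; [rewrite invr_ge0|apply: qscale_ge0].
Qed.

End Ideal.

(** Inclusions between kernels are tested on positive elements, the only ones that
    (T2) and (T3) speak of. *)
Lemma trunc_ideal_pos_sub (K M : set A) : trunc_ideal K -> trunc_ideal M ->
  (forall a, 0 <= a -> K a -> M a) -> K `<=` M.
Proof.
move=> idK idM KM x Kx; apply/(trunc_ideal_labs idM).
by apply: KM; [exact: labs_ge0|exact/(trunc_ideal_labs idK)].
Qed.

Lemma trunc_ideal_bigcap (I : Type) (D : set I) (K : I -> set A) :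
  (forall i, D i -> trunc_ideal (K i)) -> trunc_ideal (\bigcap_(i in D) K i).
Proof.
move=> idK; split.
- by move=> i Di; apply: trunc_ideal0 (idK i Di).
- by move=> x y Kx Ky i Di; apply: (trunc_idealB (idK i Di)); [exact: Kx|exact: Ky].
- by move=> x y Ky xy i Di; apply: (trunc_ideal_solid (idK i Di) _ xy); exact: Ky.
- by move=> a a0 Ka i Di; apply: (trunc_ideal_trunc (idK i Di) a0); exact: Ka.
- move=> a a0 Ka i Di; apply: (trunc_ideal_cotrunc (idK i Di) a0) => n n0.
  exact: Ka.
- move=> a b a0 b0 Ka i Di; apply: (trunc_ideal_arch (idK i Di) a0 b0) => n.
  exact: Ka.
Qed.

Lemma trunc_ideal_setI (K M : set A) :
  trunc_ideal K -> trunc_ideal M -> trunc_ideal (K `&` M).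
Proof.
move=> idK idM; rewrite -bigcap2inE.
by apply: trunc_ideal_bigcap => -[|[|]].
Qed.

Lemma trunc_ideal_setT : trunc_ideal setT.
Proof. by split. Qed.

Lemma trunc_ideal_set1 : trunc_ideal [set 0].
Proof.
split=> /=.
- by [].
- by move=> x y -> ->; rewrite subrr.
- move=> x y ->; rewrite labs0 => x0; apply: labs_eq0; apply: le_anti.
  by rewrite x0 labs_ge0.
- by move=> a a0; apply: truncT2.
- move=> a a0 Ka; apply: truncT3 => // n n0.
  by apply/eqP; rewrite -subr_eq0; apply/eqP; apply: Ka.
- move=> a b a0 b0 Ka; apply: (trunc_archimedean a0 b0) => n.
  by rewrite -lgsubr_ge0 -lgN_le0 opprB -(Ka n) lpos_ge.
Qed.

(** The intersection of these sets over the elements [k = |x|], [x] in [K], is the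
    relative pseudocomplement of [K] with respect to [M]; for [M = 0] it is the
    polar of [K]. *)
Definition ideal_colon (k : A) (M : set A) : set A := [set x | M (lmeet (labs x) k)].

Lemma trunc_ideal_colon k M :
  0 <= k -> trunc_ideal M -> trunc_ideal (ideal_colon k M).
Proof.
move=> k0 idM; have le_M := trunc_ideal_le idM.
have tT := trunc_truncation.
have muln_M x n : 0 <= x -> M (lmeet x k) -> M (lmeet x (k *+ n)).
  move=> x0 Mx; apply: le_M (trunc_ideal_muln idM n Mx).
    by rewrite lmeet_ge0 ?lgmuln_ge0.
  exact: lmeet_muln.
(* In the last two conditions, the element obtained from [n (a /\ k)] is bounded
   by the one obtained from [n a] and by [n k]; [muln_M] replaces [n k] by [k]. *)
split; rewrite /ideal_colon /=.
- by rewrite labs0 lmeet_l//; apply: trunc_ideal0.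
- move=> x y Mx My; apply: le_M (trunc_idealD idM Mx My).
    by rewrite lmeet_ge0 ?labs_ge0.
  rewrite ![lmeet (labs _) k]lmeetC.
  apply: le_trans (lmeetDr _ _ _); rewrite ?labs_ge0//.
  apply: lmeet_mono => //; apply: le_trans (labsD _ _) _.
  by rewrite labsN.
- move=> x y My xy; apply: le_M My; first by rewrite lmeet_ge0 ?labs_ge0.
  exact: lmeet_mono.
- move=> a a0; rewrite !labs_id ?trunc_ge0// => Ma.
  have ak0 : 0 <= lmeet a k by rewrite lmeet_ge0.
  apply: (trunc_ideal_trunc idM) => //; apply: le_M Ma; first exact: trunc_ge0.
  rewrite le_lmeet (bar_mono tT) ?lmeet_lel//.
  by apply: le_trans (lmeet_ler a k); apply: bar_le.
- move=> a a0 Ma; rewrite labs_id//; have ak0 : 0 <= lmeet a k by rewrite lmeet_ge0.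
  apply: (trunc_ideal_cotrunc idM) => // n n0.
  have e0 : 0 <= a *+ n - trunc (a *+ n) by rewrite cobar_ge0// lgmuln_ge0.
  have := Ma n n0; rewrite labs_id// => /(muln_M _ n e0); apply: le_M.
    by rewrite cobar_ge0// lgmuln_ge0.
  rewrite le_lmeet; apply/andP; split.
    apply: (cobar_mono tT); first exact: lgmuln_ge0.
    by apply: lgmuln_le; exact: lmeet_lel.
  apply: le_trans (lgmuln_le n (lmeet_ler a k)).
  by rewrite lgB_le trunc_ge0// lgmuln_ge0.
- move=> a b a0 b0 Ma; rewrite labs_id//.
  apply: (trunc_ideal_arch idM (b := b)) => //; first exact: lmeet_ge0.
  move=> n; have := Ma n; rewrite labs_id ?lpos_ge0// => /(muln_M _ n (lpos_ge0 _)).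
  apply: le_M; first exact: lpos_ge0.
  rewrite le_lmeet; apply/andP; split.
    by apply: lpos_mono; rewrite lgD2r; apply: lgmuln_le; exact: lmeet_lel.
  rewrite lposP lgmuln_ge0// andbT.
  apply: le_trans (lgmuln_le n (lmeet_ler a k)).
  by rewrite lgB_le.
Qed.

Lemma trunc_ideal_polar (B : set A) : trunc_ideal (polar B).
Proof.
have -> : polar B = \bigcap_(b in B) ideal_colon (labs b) [set 0] by [].
apply: trunc_ideal_bigcap => b _.
by apply: trunc_ideal_colon; [exact: labs_ge0|exact: trunc_ideal_set1].
Qed.

End TruncTheory.

(** * Kernels of truncation morphisms and quotients *)

Section MorphismKernel.
Context {A B : truncType} (f : A -> B).
Hypothesis fM : truncation_morphism f.

Lemma trunc_ideal_kernel : trunc_ideal [set x | f x = 0].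
Proof.
have [fD fI fU fT] := fM.
have f0 : f 0 = 0 by apply: (addrI (f 0)); rewrite -fD !addr0.
have fN x : f (- x) = - f x.
  by apply: (addrI (f x)); rewrite -fD !subrr.
have fMn x n : f (x *+ n) = f x *+ n.
  by elim: n => [|n IH]; rewrite ?mulr0n// !mulrS fD IH.
have flabs x : f (labs x) = labs (f x) by rewrite /labs fU fN.
have flpos x : f (lpos x) = lpos (f x) by rewrite /lpos fU f0.
have f_ge0 a : 0 <= a -> 0 <= f a.
  by move=> a0; rewrite -(lpos_id a0) flpos lpos_ge0.
split=> /=.
- exact: f0.
- by move=> x y fx fy; rewrite fD fN fx fy subrr.
- move=> x y fy xy; apply: labs_eq0; apply: le_anti; rewrite labs_ge0 andbT.
  have := f_ge0 (labs y - labs x); rewrite lgsubr_ge0 fD fN !flabs fy labs0 sub0r.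
  by move=> /(_ xy) H; rewrite -lgN2 oppr0.
- by move=> a a0; rewrite fT// => /truncT2 -> //; exact: f_ge0.
- move=> a a0 Ha; apply: truncT3; first exact: f_ge0.
  move=> n n0; have := Ha n n0; rewrite fD fN fT ?lgmuln_ge0// fMn.
  by move/eqP; rewrite subr_eq0 => /eqP.
- move=> a b a0 b0 Ha; apply: (@trunc_archimedean _ _ (f b)); rewrite ?f_ge0// => n.
  have := Ha n; rewrite flpos fD fN fMn => H.
  by rewrite -lgsubr_ge0 -lgN_le0 opprB -H lpos_ge.
Qed.

End MorphismKernel.

(** Bundled with its properties, so that the quotient by an ideal can carry
    canonical structures. *)
Record tideal (A : truncType) := TIdeal {
  tideal_set :> A -> Prop;
  tidealP : trunc_ideal tideal_set }.

Section Quotient.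
Context {A : truncType} (I : tideal A).
Let idI := tidealP I.

Definition tideal_pred : {pred A} := [pred x | `[< I x >]].

Lemma tideal_zmod_closed : zmod_closed tideal_pred.
Proof.
split; first by apply/asboolP; apply: trunc_ideal0.
by move=> x y /asboolP Ix /asboolP Iy; apply/asboolP; apply: trunc_idealB.
Qed.

HB.instance Definition _ :=
  GRing.isZmodClosed.Build A tideal_pred tideal_zmod_closed.

Definition tquot := Quotient.quot tideal_pred.

HB.instance Definition _ := GRing.Zmodule.on tquot.

Definition tpi (x : A) : tquot := \pi_(Quotient.quot tideal_pred)%qT x.
Definition trepr (p : tquot) : A := repr p.

Lemma treprK p : tpi (trepr p) = p. Proof. exact: reprK. Qed.

Lemma tpiP x y : tpi x = tpi y <-> I (x - y).
Proof.
split=> [/eqP|Ixy]; first by rewrite -Quotient.idealrBE => /asboolP.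
by apply/eqP; rewrite -Quotient.idealrBE; apply/asboolP.
Qed.

Implicit Types (p q s : tquot) (x y z a b : A).

Lemma tpi_surj p : exists x, tpi x = p.
Proof. by exists (trepr p); rewrite treprK. Qed.

Lemma tpiD x y : tpi (x + y) = tpi x + tpi y.
Proof. exact: Quotient.pi_add. Qed.

Lemma tpiN x : tpi (- x) = - tpi x.
Proof. exact: Quotient.pi_opp. Qed.

Lemma tpi0 : tpi 0 = 0.
Proof. by apply: (addrI (tpi 0)); rewrite -tpiD !addr0. Qed.

Lemma tpiMn x n : tpi (x *+ n) = tpi x *+ n.
Proof. by elim: n => [|n IH]; rewrite ?mulr0n ?tpi0// !mulrS tpiD IH. Qed.

Lemma tpi_eq0 x : tpi x = 0 <-> I x.
Proof. by rewrite -tpi0 tpiP subr0. Qed.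

Definition tquot_le p q : bool := `[< I (lpos (trepr p - trepr q)) >].

(** The order of the quotient is defined on representatives; [lpos] is
    subadditive, so another choice changes [lpos (x - y)] by at most an
    element of [I]. *)
Lemma tquot_leE x y : tquot_le (tpi x) (tpi y) <-> I (lpos (x - y)).
Proof.
have xI : I (trepr (tpi x) - x) by apply/tpiP; rewrite treprK.
have yI : I (trepr (tpi y) - y) by apply/tpiP; rewrite treprK.
have lpos_congr u v : I (u - v) -> I (lpos v) -> I (lpos u).
  move=> Iuv Iv; have := lposD (u - v) v; rewrite subrK.
  move=> /(trunc_ideal_le idI (lpos_ge0 u)); apply.
  by apply: trunc_idealD => //; apply: trunc_ideal_lpos.
have dI : I ((trepr (tpi x) - trepr (tpi y)) - (x - y)).
  by rewrite opprB [y - x]addrC addrACA [- _ + y]addrC -[y - _]opprB; apply: (trunc_idealB idI).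
split=> [/asboolP|H]; last by apply/asboolP; apply: lpos_congr dI H.
by apply: lpos_congr; rewrite -opprB; apply: trunc_idealN.
Qed.

Lemma tquot_le_refl : reflexive tquot_le.
Proof.
move=> p; have [x <-] := tpi_surj p; apply/tquot_leE.
by rewrite subrr lpos_id//; apply: trunc_ideal0.
Qed.

Lemma tquot_le_anti : antisymmetric tquot_le.
Proof.
move=> p q; have [x <-] := tpi_surj p; have [y <-] := tpi_surj q.
move=> /andP[/tquot_leE xy /tquot_leE yx]; apply/tpiP.
by rewrite -[x - y]lposBneg opprB; apply: trunc_idealB.
Qed.

Lemma tquot_le_trans : transitive tquot_le.
Proof.
move=> q p s; have [x <-] := tpi_surj p; have [y <-] := tpi_surj q.
have [z <-] := tpi_surj s => /tquot_leE xy /tquot_leE yz; apply/tquot_leE.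
apply: (trunc_ideal_le idI (lpos_ge0 _)) (trunc_idealD idI xy yz).
by have := lposD (x - y) (y - z); rewrite subrKA.
Qed.

HB.instance Definition _ := Order.Le_isPOrder.Build ring_display tquot
  tquot_le_refl tquot_le_anti tquot_le_trans.

Lemma tpi_leE x y : tpi x <= tpi y <-> I (lpos (x - y)).
Proof. exact: tquot_leE. Qed.

Lemma tpi_le x y : x <= y -> tpi x <= tpi y.
Proof.
move=> xy; apply/tpi_leE; suff -> : lpos (x - y) = 0 by apply: trunc_ideal0.
by apply: le_anti; rewrite lpos_ge0 lposP lexx lgBlD add0r xy.
Qed.

Definition tquot_meet p q : tquot := tpi (lmeet (trepr p) (trepr q)).
Definition tquot_join p q : tquot := - tquot_meet (- p) (- q).

Lemma tquot_meetP p q s : (s <= tquot_meet p q) = (s <= p) && (s <= q).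
Proof.
rewrite -[p in RHS]treprK -[q in RHS]treprK; have [z <-] := tpi_surj s.
apply/idP/andP => [/tpi_leE|[/tpi_leE H /tpi_leE H']].
  rewrite lpos_lmeet => H.
  split; apply/tpi_leE; apply: (trunc_ideal_le idI (lpos_ge0 _)) H.
    exact: ljoin_gel.
  exact: ljoin_ger.
apply/tpi_leE; rewrite lpos_lmeet.
apply: (trunc_ideal_le idI _ _ (trunc_idealD idI H H')).
  exact: le_trans (lpos_ge0 _) (ljoin_gel _ _).
by rewrite ljoin_le lg_leDr lpos_ge0 [leRHS]addrC lg_leDr lpos_ge0.
Qed.

Lemma tquot_leN p q : (- p <= - q) = (q <= p).
Proof.
have [x <-] := tpi_surj p; have [y <-] := tpi_surj q.
apply/idP/idP; rewrite -!tpiN => /tpi_leE H; apply/tpi_leE.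
  by move: H; rewrite opprK addrC.
by rewrite opprK addrC.
Qed.

Lemma tquot_joinP p q s : (tquot_join p q <= s) = (p <= s) && (q <= s).
Proof. by rewrite -[s]opprK tquot_leN tquot_meetP !tquot_leN opprK. Qed.

Lemma tquot_leD2r s p q : p <= q -> p + s <= q + s.
Proof.
have [x <-] := tpi_surj p; have [y <-] := tpi_surj q; have [z <-] := tpi_surj s.
by rewrite -!tpiD => /tpi_leE H; apply/tpi_leE; rewrite [y + z]addrC addrKA.
Qed.

Lemma tquot_divisible (n : nat) p : (0 < n)%N -> exists q : tquot, q *+ n = p.
Proof.
have [x <-] := tpi_surj p => n0; have [y <-] := @lgroup_divisible A n x n0.
by exists (tpi y); rewrite tpiMn.
Qed.

HB.instance Definition _ := isDivisibleLGroup.Build tquot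
  tquot_meetP tquot_joinP tquot_leD2r tquot_divisible.

Lemma tpiI : {morph tpi : x y / lmeet x y}.
Proof.
move=> x y; apply: le_anti; apply/andP; split.
  by rewrite le_lmeet !tpi_le ?lmeet_lel ?lmeet_ler.
set m := lmeet (tpi x) _; have [z zm] := tpi_surj m.
have : m <= tpi x by apply: lmeet_lel.
have : m <= tpi y by apply: lmeet_ler.
rewrite -zm => /tpi_leE zy /tpi_leE zx; apply/tpi_leE; rewrite lpos_lmeet.
apply: (trunc_ideal_le idI _ _ (trunc_idealD idI zx zy)).
  exact: le_trans (lpos_ge0 _) (ljoin_gel _ _).
by rewrite ljoin_le lg_leDr lpos_ge0 [leRHS]addrC lg_leDr lpos_ge0.
Qed.

Lemma tpiU : {morph tpi : x y / ljoin x y}.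
Proof. by move=> x y; rewrite !ljoinN tpiN tpiI !tpiN. Qed.

(** Truncation is only controlled on positive elements, so those of the quotient
    need positive representatives. *)
Lemma tpi_pos p : 0 <= p -> exists2 a, 0 <= a & tpi a = p.
Proof.
move=> p0; have [x xp] := tpi_surj p; exists (lpos x); first exact: lpos_ge0.
by rewrite /lpos tpiU xp tpi0 ljoin_l.
Qed.

Definition tquot_trunc p : tquot := tpi (trunc (lpos (trepr p))).

(** [trunc] is nonexpansive ([barB_le]), hence compatible with [I]. *)
Lemma tpi_trunc a : 0 <= a -> tquot_trunc (tpi a) = tpi (trunc a).
Proof.
move=> a0; rewrite /tquot_trunc; set r := lpos _; have r0 : 0 <= r by apply: lpos_ge0.
have /tpiP raI : tpi r = tpi a by rewrite /r /lpos tpiU treprK -tpiU ljoin_l.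
apply/tpiP; apply: (trunc_ideal_solid idI raI).
have posB_le x y : lpos (x - y) <= labs (x - y) by apply: lpos_le_labs.
have tT := @trunc_truncation A.
rewrite labs_le (le_trans (barB_le tT r0 a0))//= opprB.
apply: le_trans (barB_le tT a0 r0) _.
by rewrite -labsN opprB.
Qed.

Lemma tquot_truncation : truncation tquot_trunc.
Proof.
move=> p /tpi_pos[a a0 <-]; rewrite tpi_trunc//.
have tT := @trunc_truncation A; split.
  by rewrite -tpi0 tpi_le// trunc_ge0.
move=> q /tpi_pos[b b0 <-]; rewrite tpi_trunc// -tpiI.
have [H1 H2] := truncT1 a b a0 b0.
by split; apply: tpi_le.
Qed.

Lemma tquot_T2 p : 0 <= p -> tquot_trunc p = 0 -> p = 0.
Proof.
move=> /tpi_pos[a a0 <-]; rewrite tpi_trunc// => /tpi_eq0 Ia.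
by apply/tpi_eq0; apply: (trunc_ideal_trunc idI).
Qed.

Lemma tquot_T3 p : 0 <= p ->
  (forall n : nat, (0 < n)%N -> p *+ n = tquot_trunc (p *+ n)) -> p = 0.
Proof.
move=> /tpi_pos[a a0 <-] H; apply/tpi_eq0.
apply: (trunc_ideal_cotrunc idI) => // n n0; apply/tpi_eq0.
have := H n n0; rewrite -tpiMn tpi_trunc ?lgmuln_ge0// tpiD tpiN => ->.
by rewrite subrr.
Qed.

Lemma tquot_archimedean p q : 0 <= p -> 0 <= q ->
  (forall n, p *+ n <= q) -> p = 0.
Proof.
move=> /tpi_pos[a a0 <-] /tpi_pos[b b0 <-] H; apply/tpi_eq0.
apply: (trunc_ideal_arch idI a0 b0) => n.
by apply/tpi_leE; rewrite tpiMn.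
Qed.

Lemma tquot_trunc_ge0 p : 0 <= p -> 0 <= tquot_trunc p.
Proof. exact: bar_ge0 tquot_truncation _. Qed.

Lemma tquot_T1 p q : 0 <= p -> 0 <= q ->
  lmeet p (tquot_trunc q) <= tquot_trunc p /\ tquot_trunc p <= p.
Proof. by move=> /tquot_truncation[_]; apply. Qed.

Lemma tquot_T4 p : 0 <= p ->
  \bigcap_(n in [set n : nat | (0 < n)%N])
    polar (polar [set ominus_of tquot_trunc p n%:R]) = [set 0].
Proof.
apply: (archimedean_T4 tquot_truncation).
- exact: tquot_T2.
- exact: tquot_archimedean.
Qed.

HB.instance Definition _ := isTrunc.Build tquot
  tquot_trunc_ge0 tquot_T1 tquot_T2 tquot_T3 tquot_T4.

Lemma tpi_morphism : truncation_morphism tpi.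
Proof.
split; [exact: tpiD|exact: tpiI|exact: tpiU|].
by move=> a a0; rewrite -tpi_trunc.
Qed.

End Quotient.

Theorem truncation_kernelP (A : truncType) (K : set A) :
  truncation_kernel K <-> trunc_ideal K.
Proof.
split=> [[B [f [fM ->]]]|idK]; first exact: trunc_ideal_kernel.
exists (tquot (TIdeal idK)), (@tpi A (TIdeal idK)); split.
  exact: tpi_morphism.
by apply/seteqP; split=> x /=; case: (tpi_eq0 (TIdeal idK) x) => h1 h2; [exact: h2|exact: h1].
Qed.

(** * The frame of truncation kernels *)

Section GeneratedKernel.
Context {A : truncType}.
Implicit Types (B K M : set A) (S : set (KA A)) (a b x y : A).

Lemma trunc_ideal_generated B : trunc_ideal (generated_kernel B).
Proof. by apply: trunc_ideal_bigcap => M [/truncation_kernelP]. Qed.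

Lemma sub_generated_kernel B : B `<=` generated_kernel B.
Proof. exact: sub_gen_smallest. Qed.

Lemma generated_kernel_sub B K :
  trunc_ideal K -> B `<=` K -> generated_kernel B `<=` K.
Proof. by move=> /truncation_kernelP; apply: smallest_sub. Qed.

Lemma generated_kernelS B M : B `<=` M -> generated_kernel B `<=` generated_kernel M.
Proof.
move=> BM; apply: generated_kernel_sub; first exact: trunc_ideal_generated.
by apply: subset_trans BM _; apply: sub_generated_kernel.
Qed.

Definition KA_mk K (idK : trunc_ideal K) : KA A :=
  TruncationKernel (asboolT ((truncation_kernelP K).2 idK)).

Lemma KA_ideal (K : KA A) : trunc_ideal (KA_val K).
Proof. by case: K => K /= /asboolP/truncation_kernelP. Qed.

Lemma leKA (K M : KA A) : (K <= M)%O <-> KA_val K `<=` KA_val M.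
Proof. by rewrite -Order.le_val subsetEset. Qed.

Definition KA_union S : set A := \bigcup_(K in S) KA_val K.

Lemma KA_sup S : supremums S (KA_mk (trunc_ideal_generated (KA_union S))).
Proof.
split=> [K SK|U ubU]; apply/leKA => /=.
  by move=> x Kx; apply: sub_generated_kernel; exists K.
apply: generated_kernel_sub; first exact: KA_ideal.
by move=> x [K /ubU/leKA + Kx]; apply.
Qed.

Lemma KA_is_meet (K M N : KA A) :
  is_meet K M N <-> KA_val N = KA_val K `&` KA_val M.
Proof.
have idI := trunc_ideal_setI (KA_ideal K) (KA_ideal M).
rewrite is_meetP; split=> [H|NE U].
  apply/seteqP; split.
    have := lexx N; rewrite H => /andP[/leKA NK /leKA NM] x Nx.
    by split; [apply: NK|apply: NM].
  apply/(leKA (KA_mk idI)); rewrite H; apply/andP.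
  by split; apply/leKA => x [].
apply/idP/andP => [/leKA|[/leKA UK /leKA UM]].
  by rewrite NE => UKM; split; apply/leKA => x /UKM[].
by apply/leKA; rewrite NE => x Ux; split; [apply: UK|apply: UM].
Qed.

Lemma KA_bot (b : KA A) : is_bot b <-> KA_val b = [set 0].
Proof.
split=> [botb|bE K _]; last first.
  by apply/leKA; rewrite bE => _ ->; apply: trunc_ideal0 (KA_ideal K).
apply/seteqP; split; last by move=> _ ->; apply: trunc_ideal0 (KA_ideal b).
by apply/(leKA b (KA_mk trunc_ideal_set1)); apply: botb.
Qed.

Lemma KA_top (t : KA A) : is_top t <-> KA_val t = setT.
Proof.
split=> [topt|tE K _]; last by apply/leKA; rewrite tE.
apply/seteqP; split=> //.
by apply/(leKA (KA_mk trunc_ideal_setT)); apply: topt.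
Qed.

(** Distributivity: each [K] in [S] lies in the kernel of all [x] such that
    [|x| /\ |k|] is in [U] for all [k] in [a], hence so does the join of [S]. *)
Lemma KA_frame : is_frame (KA A).
Proof.
split=> [S|K M|a S s m Ss /[dup] asm /KA_is_meet mE].
- by eexists; apply: KA_sup.
- have idI := trunc_ideal_setI (KA_ideal K) (KA_ideal M).
  by exists (KA_mk idI); apply/KA_is_meet.
split=> [z [x Sx /KA_is_meet zE]|U ubU]; apply/leKA; rewrite mE.
  rewrite zE => v [av xv]; split=> //; case: Ss => /(_ _ Sx)/leKA + _.
  exact.
pose V := \bigcap_(k in KA_val a) ideal_colon (labs k) (KA_val U).
have idV : trunc_ideal V.
  apply: trunc_ideal_bigcap => k _.
  by apply: trunc_ideal_colon; [exact: labs_ge0|exact: KA_ideal].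
have /leKA sV : (s <= KA_mk idV)%O.
  case: Ss => _; apply=> K SK; apply/leKA => x Kx k ak.
  have idI := trunc_ideal_setI (KA_ideal a) (KA_ideal K).
  have /leKA : (KA_mk idI <= U)%O by apply: ubU; exists K => //; apply/KA_is_meet.
  apply; split.
    apply: (trunc_ideal_le (KA_ideal a)) (lmeet_ler _ _) _.
      by rewrite lmeet_ge0 ?labs_ge0.
    exact/(trunc_ideal_labs (KA_ideal a)).
  apply: (trunc_ideal_le (KA_ideal K)) (lmeet_lel _ _) _.
    by rewrite lmeet_ge0 ?labs_ge0.
  exact/(trunc_ideal_labs (KA_ideal K)).
move=> x [ax sx]; apply/(trunc_ideal_labs (KA_ideal U)).
by have := sV x sx x ax; rewrite /ideal_colon /= lmeetxx.
Qed.

(** The elements generated by countable subfamilies form a kernel: each closure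
    condition has countably many premises, and a countable union of countable
    subfamilies is countable. *)
Lemma countable_generation S x : generated_kernel (KA_union S) x ->
  exists S0, [/\ S0 `<=` S, countable S0 & generated_kernel (KA_union S0) x].
Proof.
pose U : set A := [set x | exists S0,
  [/\ S0 `<=` S, countable S0 & generated_kernel (KA_union S0) x]].
have seqU (g : nat -> A) : (forall n, U (g n)) -> exists S0,
    [/\ S0 `<=` S, countable S0 & forall n, generated_kernel (KA_union S0) (g n)].
  move=> /choice[T HT]; exists (\bigcup_n T n); split.
  - by move=> K [n _]; have [TS _ _] := HT n; apply: TS.
  - by apply: bigcup_countable => // n _; have [] := HT n.
  - move=> n; have [_ _] := HT n; apply: generated_kernelS => y [K TK Ky].
    by exists K => //; exists n.
suff idU : trunc_ideal U.
  apply: (generated_kernel_sub idU) => y [K SK Ky].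
  exists [set K]; split; [by move=> _ ->|exact: countable1|].
  by apply: sub_generated_kernel; exists K.
have gen_id S0 := trunc_ideal_generated (KA_union S0).
split.
- exists set0; split; [exact: sub0set|exact: countable0|exact: trunc_ideal0].
- move=> y z Uy Uz; have [[|]//|S0 [S0S cS0 HS0]] :=
    seqU (fun n => if n is 0 then y else z).
  by exists S0; split=> //; apply: (trunc_idealB (gen_id S0) (HS0 0) (HS0 1)).
- move=> y z [S0 [S0S cS0 Hz]] yz; exists S0; split=> //.
  exact: trunc_ideal_solid (gen_id S0) _ _ Hz yz.
- move=> a a0 [S0 [S0S cS0 Ha]]; exists S0; split=> //.
  exact: (trunc_ideal_trunc (gen_id S0) a0).
- move=> a a0 Ua; have [n|S0 [S0S cS0 HS0]] :=
    seqU (fun n => a *+ n.+1 - trunc (a *+ n.+1)); first exact: Ua.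
  exists S0; split=> //; apply: (trunc_ideal_cotrunc (gen_id S0) a0) => -[//|n] _.
  exact: HS0.
- move=> a b a0 b0 Ua; have [n|S0 [S0S cS0 HS0]] :=
    seqU (fun n => lpos (a *+ n - b)); first exact: Ua.
  by exists S0; split=> //; apply: (trunc_ideal_arch (gen_id S0) a0 b0).
Qed.

End GeneratedKernel.

(** * The spectral filter *)

Section SpectralFilter.
Context {A : truncType}.
Implicit Types (K M : set A) (a b c x y : A) (r s : rat).

Let tT : truncation (@trunc A) := @trunc_truncation A.

(** [K] contains an element that is positive on [a > r] and all elements living on
    [a < s], and these regions cover. In detail, a multiple of [bar b] is
    at most the sum of [a (-) r] and of an element disjoint from [a (-) s]. *)
Lemma trunc_ideal_total K a r s : trunc_ideal K -> 0 <= a -> 0 <= r -> r < s ->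
  K (ominus a r) -> polar [set ominus a s] `<=` K -> K = setT.
Proof.
move=> idK a0 r0 rs Kr Ks; apply/seteqP; split=> //.
apply: (trunc_ideal_pos_sub trunc_ideal_setT idK).
move=> b b0 _; apply: (trunc_ideal_trunc idK) => //.
have sr0 : 0 < s - r by rewrite subr_gt0.
apply: (trunc_ideal_qscaleV idK sr0); first exact: trunc_ge0.
set p := qscale (s - r) (trunc b).
have p0 : 0 <= p by apply: qscale_ge0; [exact: ltW|exact: trunc_ge0].
have ar0 : 0 <= ominus a r := ominus_of_ge0 tT r0 a0.
have as0 : 0 <= ominus a s := ominus_of_ge0 tT (ltW (le_lt_trans r0 rs)) a0.
have Kp : K (lpos (p - ominus a r)).
  apply: Ks => _ ->; rewrite !labs_id ?lpos_ge0//.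
  apply: lmeet_eq0_le (lpos_disjoint p (ominus a r)) => //; first exact: lpos_ge0.
  exact: (ominus_of_le tT).
apply: (trunc_ideal_le idK p0 _ (trunc_idealD idK Kp Kr)).
by rewrite -lgBlD lpos_ge.
Qed.

Lemma trunc_ideal_total0 K a s : trunc_ideal K -> 0 <= a -> 0 < s ->
  K a -> polar [set ominus a s] `<=` K -> K = setT.
Proof.
move=> idK a0 s0 Ka; apply: (@trunc_ideal_total _ _ 0) => //.
by rewrite /ominus /ominus_of qscale0 subr0.
Qed.

Lemma trunc_ideal_btl a r : trunc_ideal (btl a r).
Proof. exact: trunc_ideal_generated. Qed.

Lemma polar_sub_btl a r s : 0 < s < r -> polar [set ominus a s] `<=` btl a r.
Proof. by move=> sr x Hx; apply: sub_generated_kernel; exists s. Qed.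

Lemma polarS x y : 0 <= x -> x <= y -> polar [set y] `<=` polar [set x].
Proof.
move=> x0 xy z /(_ _ erefl) zy _ ->; apply: lmeet_eq0_le zy; rewrite ?labs_ge0//.
by rewrite !labs_id// (le_trans x0).
Qed.

Lemma btl_antimono a b r : 0 <= a -> a <= b -> btl b r `<=` btl a r.
Proof.
move=> a0 ab; apply: generated_kernelS => x [s /= /andP[s0 sr] Hx].
exists s => /=; first by rewrite s0.
apply: polarS Hx; first exact: (ominus_of_ge0 tT (ltW s0) a0).
rewrite /ominus !ominus_of_scale ?lt0r_neq0// qscale_le ?(ltW s0)//.
apply: (cobar_mono tT); last by rewrite qscale_le// invr_ge0 ltW.
by rewrite qscale_ge0// invr_ge0 ltW.
Qed.

(** Let [c] be the meet of [|x|] and [b - bar b], where [x] is disjoint from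
    [bar b (-) s]. A positive multiple of [bar c] is below [bar b (-) s] and below
    [|x|], hence it is zero. *)
Lemma btl_trunc_sub_polar b : 0 <= b ->
  btl (trunc b) 1 `<=` polar [set b - trunc b].
Proof.
move=> b0; apply: generated_kernel_sub; first exact: trunc_ideal_polar.
move=> x [s /= /[dup] /andP[s0 s1] s01 /(_ _ erefl) xs _ ->].
rewrite [labs (b - _)]labs_id; last exact: (cobar_ge0 tT b0).
set c := lmeet _ _; have c0 : 0 <= c.
  by rewrite lmeet_ge0 ?labs_ge0//; exact: (cobar_ge0 tT b0).
apply: truncT2 => //; have tc0 := trunc_ge0 c c0.
have s10 : 0 < 1 - s by rewrite subr_gt0.
apply: (trunc_ideal_qscaleV trunc_ideal_set1 s10 tc0) => /=.
rewrite -[LHS]lmeetxx; apply: lmeet_eq0_le xs.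
- exact: qscale_ge0 (ltW s10) tc0.
- exact: qscale_ge0 (ltW s10) tc0.
- apply: le_trans (lmeet_lel _ (b - trunc b)); rewrite -/c.
  apply: le_trans (bar_le tT c0); rewrite -[leRHS]qscale1 qscale_ler//.
  by rewrite gerBl ltW.
- apply: le_trans (labs_ge _); apply: (qscale_bar_le_ominus_bar tT) => //.
  exact: lmeet_ler.
Qed.

Lemma generated_cotrunc_btl b : 0 <= b ->
  generated_kernel [set b - trunc b] `&` btl (trunc b) 1 = [set 0].
Proof.
move=> b0; apply/seteqP; split=> [x [Hx /(btl_trunc_sub_polar b0) px]|_ ->].
  have : polar (polar [set b - trunc b]) x.
    apply: generated_kernel_sub Hx; first exact: trunc_ideal_polar.
    by move=> _ -> y /(_ _ erefl); rewrite lmeetC.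
  by move=> /(_ _ px); rewrite lmeetxx => /labs_eq0.
by split; apply: trunc_ideal0 (trunc_ideal_generated _).
Qed.

Lemma truncA_ge0 a : truncA a -> 0 <= a.
Proof. by move=> [c c0 <-]; apply: trunc_ge0. Qed.

Lemma truncA_ljoin a b : truncA a -> truncA b -> truncA (ljoin a b).
Proof.
move=> [c c0 <-] [e e0 <-]; set j := ljoin _ _.
have j0 : 0 <= j by apply: le_trans (ljoin_gel _ _); apply: trunc_ge0.
exists j => //; apply: le_anti; rewrite (bar_le tT j0) ljoin_le.
by rewrite (le_bar tT j0 c0 (ljoin_gel _ _))// (le_bar tT j0 e0 (ljoin_ger _ _)).
Qed.

Lemma spectral_filter_lattice : lattice_filter (@spectral_filter A).
Proof.
split=> [t topt|x y z Fx Fy xyz|x y Fx xy] G [filG genG].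
- by have [topG _ _] := filG; apply: topG.
- by have [_ meetG _] := filG; apply: meetG xyz; [apply: Fx|apply: Fy].
- by have [_ _ upG] := filG; apply: upG xy; apply: Fx.
Qed.

Lemma spectral_filter_btl a : truncA a ->
  spectral_filter (KA_mk (trunc_ideal_btl a 1)).
Proof. by move=> Aa; apply: sub_gen_smallest; exists a. Qed.

(** The generators are closed under finite meets up to refinement, because
    [a <| 1] decreases as [a] increases and [a \/ b] is again truncated. *)
Lemma spectral_filter_base (K : KA A) : spectral_filter K ->
  exists2 a, truncA a & btl a 1 `<=` KA_val K.
Proof.
move=> FK; pose G := [set K : KA A | exists2 a, truncA a & btl a 1 `<=` KA_val K].
suff filG : lattice_filter G.
  by apply: (FK G); split=> // M [a Aa ME]; exists a => //; rewrite ME.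
split=> [t /KA_top tE|x y z [a Aa ax] [b Ab bz] /KA_is_meet zE|x y [a Aa ax] /leKA xy].
- by exists 0; [exists 0 => //=; exact: (bar0 tT)|rewrite /= tE].
- exists (ljoin a b); first exact: truncA_ljoin.
  rewrite zE => v Hv; split; [apply: ax|apply: bz]; apply: btl_antimono Hv.
  + exact: truncA_ge0.
  + exact: ljoin_gel.
  + exact: truncA_ge0.
  + exact: ljoin_ger.
- by exists a => //; apply: subset_trans xy.
Qed.

Lemma KA_is_join_top (K M t : KA A) : is_top t ->
  (forall U : KA A, KA_val K `<=` KA_val U -> KA_val M `<=` KA_val U ->
    KA_val U = setT) -> is_join K M t.
Proof.
move=> topt H; apply/is_joinP => U; apply/idP/andP => [tU|[/leKA KU /leKA MU]].
  by split; apply: le_trans tU; apply: topt.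
by apply/leKA; rewrite (H U KU MU).
Qed.

(** The kernel generated by [b - bar b], [b = n a], is rather below [x] for every
    [n > 0] and every [a >= 0] in [x]; an upper bound of these kernels contains [a]. *)
Lemma KA_regular (x : KA A) :
  supremums [set y : KA A | exists w b t : KA A, [/\ spectral_filter w, is_bot b,
    is_top t, is_meet y w b & is_join x w t]] x.
Proof.
split=> [y [w [b [t [_ botb topt yw xw]]]]|u ubu].
  by apply: (rather_below_le KA_frame); exists w, b, t.
apply/leKA; apply: trunc_ideal_pos_sub; try exact: KA_ideal.
move=> a a0 xa; apply: (trunc_ideal_cotrunc (KA_ideal u)) => // n n0.
have b0 := lgmuln_ge0 n a0; set b := a *+ n in b0 *.
have xb : KA_val x b by apply: trunc_ideal_muln => //; exact: KA_ideal.
pose y := KA_mk (trunc_ideal_generated [set b - trunc b]).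
suff /ubu/leKA : [set y : KA A | exists w b t : KA A, [/\ spectral_filter w, is_bot b,
    is_top t, is_meet y w b & is_join x w t]] y.
  by apply; apply: sub_generated_kernel.
have Ab : truncA (trunc b) by exists b.
exists (KA_mk (trunc_ideal_btl (trunc b) 1)), (KA_mk trunc_ideal_set1),
  (KA_mk trunc_ideal_setT); split.
- exact: spectral_filter_btl.
- exact/KA_bot.
- exact/KA_top.
- by apply/KA_is_meet; rewrite /= generated_cotrunc_btl.
apply: KA_is_join_top; first exact/KA_top.
move=> U xU wU; apply: (@trunc_ideal_total0 _ (trunc b) (1 / 2)) => //.
- exact: KA_ideal.
- exact: trunc_ge0.
- apply: xU; apply: (trunc_ideal_le (KA_ideal x)) xb; first exact: trunc_ge0.
  exact: (bar_le tT).
- by apply: subset_trans wU; apply: polar_sub_btl.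
Qed.

(** [a <| 1] covers [a < 1], and [2 a - bar (2 a)] is positive on [a > 1/2]. *)
Lemma spectral_filter_regular (x : KA A) : spectral_filter x ->
  exists2 y, spectral_filter y & rather_below y x.
Proof.
move=> /spectral_filter_base[a Aa ax]; have a0 := truncA_ge0 Aa.
have b0 := lgmuln_ge0 2 a0; set b := a *+ 2 in b0 *.
have Ab : truncA (trunc b) by exists b.
exists (KA_mk (trunc_ideal_btl (trunc b) 1)); first exact: spectral_filter_btl.
exists (KA_mk (trunc_ideal_generated [set b - trunc b])), (KA_mk trunc_ideal_set1),
  (KA_mk trunc_ideal_setT); split.
- exact/KA_bot.
- exact/KA_top.
- by apply/KA_is_meet; rewrite /= setIC generated_cotrunc_btl.
apply: KA_is_join_top; first exact/KA_top.
(* [2 a - bar (2 a)] is twice [a (-) 1/2], and any [s] with [1/2 < s < 1] does *)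
move=> U xU wU; apply: (@trunc_ideal_total _ a 2^-1 (3 / 4)) => //.
- exact: KA_ideal.
- rewrite /ominus ominus_of_scale// invrK (qscale_nat 2) -/b.
  apply: (trunc_ideal_qscale (KA_ideal U)) => //; first exact: (cobar_ge0 tT).
  by apply: wU; apply: sub_generated_kernel.
- by apply: subset_trans xU; apply: subset_trans ax; apply: polar_sub_btl.
Qed.

(** [x] contains some [a <| 1], and together with [a] it generates everything; so
    it is enough to cover the one element [a]. *)
Lemma KA_lindelof (x : KA A) (S : set (KA A)) t :
  spectral_filter x -> is_top t -> supremums S t ->
  exists S0, [/\ S0 `<=` S, countable S0 & supremums (x |` S0) t].
Proof.
move=> /spectral_filter_base[a Aa ax] topt [_ leS].
have [ubS _] := KA_sup S; have /leKA := leS _ ubS.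
have /KA_top -> := topt => /(_ a I)/countable_generation[S0 [S0S cS0 S0a]].
exists S0; split=> //; split=> [y _|U ubU]; first exact: topt.
apply/leKA; rewrite (@trunc_ideal_total0 (KA_val U) a (1 / 2))//.
- exact: KA_ideal.
- exact: truncA_ge0.
- apply: generated_kernel_sub S0a; first exact: KA_ideal.
  by move=> y [K S0K Ky]; have /leKA := ubU _ (or_intror S0K); apply.
- have /leKA xU := ubU _ (or_introl erefl).
  by apply: subset_trans xU; apply: subset_trans ax; apply: polar_sub_btl.
Qed.

End SpectralFilter.

(** * The spectral frame *)

Theorem theorem4p7p1 (A : truncType) :
  [/\ is_frame (spectral_frame A),
      regular_frame (spectral_frame A)
    & lindelof_frame (spectral_frame A)].
Proof.
have frameK := @KA_frame A; have filterF := @spectral_filter_lattice A.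
split.
- exact: two_F_frame frameK filterF.
- apply: two_F_regular frameK filterF _ _; first exact: KA_regular.
  exact: spectral_filter_regular.
- by apply: two_F_lindelof frameK filterF _; exact: KA_lindelof.
Qed.
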